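(* Let $\alpha$ be a special Pisot unit, $\beta=\alpha/(\alpha-1)$, such that $\alpha^2=\beta^p$ holds for an integer $p\ge3$ (i.e. $p\in\{3,4,6,8,10\}$). Let $\zeta'_p$ be the following substitution. If $p$ is odd, $\mathcal{A}=\{0,\dots,2p-1\}$ and $$0\mapsto(p+1)\,p,\quad k\mapsto p+k+1\ (1\le k\le p-2),\quad (p-1)\mapsto0\,(2p-1),$$ $$p\mapsto 0\,1,\quad p+k\mapsto k+1\ (1\le k\le p-2),\quad (2p-1)\mapsto(p-1)\,p$$ (so $\zeta'_3:0\mapsto43,\ 1\mapsto5,\ 2\mapsto05,\ 3\mapsto01,\ 4\mapsto2,\ 5\mapsto23$). If $p$ is even, $\mathcal{A}=\{0,\dots,p-1\}$ and $$0\mapsto 2\,0\,1,\quad k\mapsto k+2\ (1\le k\le p-3),\quad (p-2)\mapsto0\,(p-1),\quad (p-1)\mapsto0\,(p-1)\,0\,1.$$ Then $\zeta'_p$ is a primitive unimodular Pisot substitution with dominant root $\beta$ if $p$ is odd and $\beta^2$ if $p$ is even, and $\mathcal{R}_{\zeta'_p}(k)\cong X_k$ for each $k\in\mathcal{A}$, where for $p\in\{4,6,8,10\}$ $$X_k=\begin{cases}\Psi[\alpha\beta^k](\mathcal{F}_\alpha), & k\in\{0,2,\dots,p-2\};\\ \psi(\beta^k)-\Psi[\alpha\beta^k](\mathcal{F}_\alpha), & k\in\{1,3,\dots,p-3\};\\ \psi(\beta^{p-1})-\Psi[\beta^{p-1}](\mathcal{F}_\alpha), & k=p-1,\end{cases}$$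 and for $p=3$ $$X_0=\Psi[\alpha](\mathcal{F}_\alpha),\quad X_1=\psi(\beta)-\Psi[\alpha\beta](\mathcal{F}_\alpha),\quad X_2=\Psi[\beta^2](\mathcal{F}_\alpha),$$ $$X_3=\psi(\alpha)-\Psi[\alpha](\mathcal{F}_\alpha),\quad X_4=\Psi[\alpha\beta](\mathcal{F}_\alpha),\quad X_5=\psi(\beta^2)-\Psi[\beta^2](\mathcal{F}_\alpha).$$
   Context: Tent-tiles. A Pisot number is an algebraic integer that is a real number $>1$ whose other Galois conjugates have modulus $<1$. A special Pisot unit is a Pisot number $\alpha$ that is an algebraic unit and for which $\beta=\alpha/(\alpha-1)$ is also a Pisot number. Let $d+1$ be the degree of $\alpha$, with further real conjugates $\alpha^{(1)},\dots,\alpha^{(r)}$ and non-real conjugates $\alpha^{(r+1)},\overline{\alpha^{(r+1)}},\dots,\alpha^{(r+s)},\overline{\alpha^{(r+s)}}$. Put $\mathbb{K}_\alpha=\mathbb{R}^r\times\mathbb{C}^s$; for $z\in\mathbb{Q}(\alpha)$ let $z^{(k)}$ be its image under $\alpha\mapsto\alpha^{(k)}$, $\psi(z)=(z^{(1)},\dots,z^{(r+s)})^T$, and $\Psi[z](x_1,\dots,x_{r+s})=(z^{(1)}x_1,\dots,z^{(r+s)}x_{r+s})^T$. Put $f_L(x)=\Psi[\alpha](x)$, $f_R(x)=\Psi[\beta](\psi(1)-x)$. The tent-tile $\mathcal{F}_\alpha$ is the unique non-empty compact set with $\mathcal{F}_\alpha=f_L(\mathcal{F}_\alpha)\cup f_R(\mathcal{F}_\alpha)$.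 For a set $F$, $c-F=\{c-y:y\in F\}$. Rauzy fractals. Let $\mathcal{A}=\{0,\dots,m\}$ and $\mathcal{A}^*$ the free monoid of finite words over $\mathcal{A}$ (empty word $\varepsilon$). For $W\in\mathcal{A}^*$ let $\ell(W)=(|W|_0,\dots,|W|_m)^T$ count letter occurrences. A substitution $\zeta$ is a non-erasing endomorphism of $\mathcal{A}^*$; its incidence matrix $M_\zeta$ has columns $\ell(\zeta(0)),\dots,\ell(\zeta(m))$. It is primitive if some power $\zeta^k$ ($k\ge1$) has all entries of $\ell(\zeta^k(a))$ positive for every $a\in\mathcal{A}$. For primitive $\zeta$, the dominant root $\lambda$ is the Perron–Frobenius eigenvalue of $M_\zeta$; $\zeta$ is unimodular if $\det M_\zeta=\pm1$ and Pisot if $\lambda$ is a Pisot number. Let $\nu$ be a left eigenvector of $M_\zeta$ for $\lambda$ with strictly positive entries in $\mathbb{Q}(\lambda)$. With the conjugates of $\lambda$ different from $\lambda$ being real $\lambda^{(1)},\dots,\lambda^{(r)}$ and non-real $\lambda^{(r+1)},\overline{\lambda^{(r+1)}},\dots,\lambda^{(r+s)},\overline{\lambda^{(r+s)}}$, put $\mathbb{K}_\zeta=\mathbb{R}^r\times\mathbb{C}^s$, $\pi(z)=(z^{(1)},\dots,z^{(r+s)})^T$ for $z\in\mathbb{Q}(\lambda)$ (images under $\lambda\mapsto\lambda^{(k)}$), $h(x_1,\dots,x_{r+s})=(\lambda^{(1)}x_1,\dots,\lambda^{(r+s)}x_{r+s})^T$, and for $U\in\mathcal{A}^*$, $g_U(x)=\pi(\langle\nu,\ell(U)\rangle)+h(x)$.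 The sets $\mathcal{R}_\zeta(a)$, $a\in\mathcal{A}$, are the unique non-empty compact subsets of $\mathbb{K}_\zeta$ with $$\mathcal{R}_\zeta(a)=\bigcup_{(b,U,V):\ \zeta(b)=UaV} g_U(\mathcal{R}_\zeta(b))\qquad(a\in\mathcal{A},\ b\in\mathcal{A},\ U,V\in\mathcal{A}^* ).$$ They are determined up to a linear isomorphism (depending on the choice of $\nu$ and of the ordering of conjugates). Here ''$\mathcal{R}_\zeta(k)\cong X_k$ for each $k$'' means: there is a linear bijection $\Phi:\mathbb{K}_\alpha\to\mathbb{K}_\zeta$, the same for all $k\in\mathcal{A}$, with $\mathcal{R}_\zeta(k)=\Phi(X_k)$. *)

(* Defs.v *)
From HB Require Import structures.
From mathcomp Require Import all_boot all_order all_algebra.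
From mathcomp Require Import all_classical all_reals all_analysis.
From mathcomp Require Import complex.

Set Implicit Arguments.
Unset Strict Implicit.
Unset Printing Implicit Defensive.

Import Order.TTheory GRing.Theory Num.Theory.
Import numFieldNormedType.Exports.

Local Open Scope classical_set_scope.
Local Open Scope ring_scope.
Local Open Scope complex_scope.

Section AlgebraicNumbers.
Variable R : realType.

(* [q] is the minimal polynomial of [x] over the rationals. *)
Definition galois_conjugate (x : R) (z : R[i]) : Prop :=
  exists q : {poly rat},
    [/\ q \is monic, irreducible_poly q, root (map_poly ratr q) x
      & root (map_poly ratr q) z].

Definition algebraic_integer (x : R) : Prop :=
  integralOver (intr : int -> R) x.

Definition algebraic_unit (x : R) : Prop :=
  [/\ x != 0, algebraic_integer x & algebraic_integer x^-1].

Definition pisot_number (x : R) : Prop :=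
  [/\ algebraic_integer x, 1 < x
    & forall z : R[i], galois_conjugate x z -> z != x%:C -> `|z| < 1].

Definition special_pisot_unit (x : R) : Prop :=
  [/\ pisot_number x, algebraic_unit x & pisot_number (x / (x - 1))].

(* [cr] lists the real conjugates of [x] other than [x], and [cc] contains
   exactly one member of each pair of non-real conjugates (the elements of [cc]
   cannot be real because [cc] and its complex conjugate are disjoint). *)
Definition conjugate_listing (x : R) r s
    (cr : r.-tuple R) (cc : s.-tuple R[i]) : Prop :=
  let l := [seq c%:C | c <- cr] ++ cc ++ [seq conjc c | c <- cc] in
  uniq l /\ forall z : R[i], z \in l <-> galois_conjugate x z /\ z != x%:C.

Definition in_field (x z : R) : Prop :=
  exists q : {poly rat}, (map_poly ratr q).[x] = z.

(* Image of [z] in Q(x) under the field embedding sending [x] to its conjugate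
   [y]: write z = q(x) with q in Q[X] and return q(y), which does not depend on
   [q].  The value is 0 if [z] is not in Q(x). *)
Definition field_image (K : numFieldType) (x : R) (y : K) (z : R) : K :=
  xget 0 [set w | exists q : {poly rat},
                    (map_poly ratr q).[x] = z /\ (map_poly ratr q).[y] = w].

End AlgebraicNumbers.

(* R^r x C^s with the product topology, as a real vector space. *)
Definition Kspace (R : realType) (r s : nat) : Type :=
  ('rV[R]_r * 'rV[R[i]^o]_s)%type.

Section KspaceStructure.
Variables (R : realType) (r s : nat).

HB.instance Definition _ :=
  Topological.copy (Kspace R r s) ('rV[R]_r * 'rV[R[i]^o]_s)%type.
HB.instance Definition _ :=
  GRing.Zmodule.copy (Kspace R r s) ('rV[R]_r * 'rV[R[i]^o]_s)%type.

Definition Kscale (c : R) (x : Kspace R r s) : Kspace R r s :=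
  (c *: x.1, c%:C *: x.2).

Lemma KscaleA a b x : Kscale a (Kscale b x) = Kscale (a * b) x.
Proof. by rewrite /Kscale /= !scalerA rmorphM. Qed.

Lemma Kscale1 : left_id 1 Kscale.
Proof. by move=> [x y]; rewrite /Kscale /= !scale1r. Qed.

Lemma KscaleDr : right_distributive Kscale +%R.
Proof. by move=> a [x y] [x' y']; rewrite /Kscale /= !scalerDr. Qed.

Lemma KscaleDl x : {morph Kscale^~ x : a b / a + b}.
Proof. by move=> a b; rewrite /Kscale rmorphD !scalerDl. Qed.

HB.instance Definition _ :=
  GRing.Zmodule_isLmodule.Build R (Kspace R r s)
    KscaleA Kscale1 KscaleDr KscaleDl.

Definition Kmul (u x : Kspace R r s) : Kspace R r s :=
  (\row_k (u.1 0 k * x.1 0 k), \row_k (u.2 0 k * x.2 0 k)).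

Variables (a : R) (cr : r.-tuple R) (cc : s.-tuple R[i]).

(* [psi] is also the map written pi for Rauzy fractals, with [a] the dominant
   root. *)
Definition psi (z : R) : Kspace R r s :=
  (\row_k field_image a (tnth cr k) z, \row_k field_image a (tnth cc k) z).

Definition Psi (z : R) (x : Kspace R r s) : Kspace R r s := Kmul (psi z) x.

Definition set_sub (c : Kspace R r s) (F : set (Kspace R r s)) :
  set (Kspace R r s) := [set c - y | y in F].

(* As a contractive iterated function system has a single non-empty compact
   attractor, this property identifies the tent-tile. *)
Definition is_tent_tile (F : set (Kspace R r s)) : Prop :=
  let b := a / (a - 1) in
  [/\ F !=set0, compact F
    & F = [set Psi a x | x in F] `|` [set Psi b (psi 1 - x) | x in F]].

End KspaceStructure.

Section Substitutions.
Variable m : nat.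
Let A := 'I_m.+1.

(* An endomorphism of the free monoid is given by the images of the letters. *)
Implicit Type zeta : A -> seq A.

Definition subst_ext zeta (w : seq A) : seq A := flatten (map zeta w).

Definition nonerasing zeta : Prop := forall a, zeta a != [::].

Definition ell (w : seq A) : 'cV[int]_m.+1 := \col_i (count_mem i w)%:Z.

Definition incidence zeta : 'M[int]_m.+1 := \matrix_(i, j) ell (zeta j) i 0.

Definition primitive_subst zeta : Prop :=
  exists2 k, (0 < k)%N &
    forall a b : A, 0 < ell (iter k (subst_ext zeta) [:: a]) b 0.

Definition unimodular zeta : Prop :=
  \det (incidence zeta) = 1 \/ \det (incidence zeta) = -1.

(* Perron-Frobenius eigenvalue: a real positive eigenvalue strictly dominating
   all the other complex ones. *)
Definition dominant_root (R : realType) zeta (lam : R) : Prop :=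
  [/\ 0 < lam, eigenvalue (map_mx intr (incidence zeta) : 'M[R]_m.+1) lam
    & forall mu : R[i],
        eigenvalue (map_mx intr (incidence zeta) : 'M[R[i]]_m.+1) mu ->
        mu != lam%:C -> `|mu| < lam%:C].

Definition pisot_subst (R : realType) zeta : Prop :=
  exists2 lam : R, dominant_root zeta lam & pisot_number lam.

Definition left_eigenvector (R : realType) zeta (lam : R)
    (nu : 'rV[R]_m.+1) : Prop :=
  nu *m map_mx intr (incidence zeta) = lam *: nu /\
  forall i, 0 < nu 0 i /\ in_field lam (nu 0 i).

Section Rauzy.
Variables (R : realType) (r s : nat) (lam : R).
Variables (cr : r.-tuple R) (cc : s.-tuple R[i]) (nu : 'rV[R]_m.+1).

Definition hmap (x : Kspace R r s) : Kspace R r s :=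
  Kmul (\row_k tnth cr k, \row_k (tnth cc k : R[i]^o)) x.

Definition gmap (U : seq A) (x : Kspace R r s) : Kspace R r s :=
  psi lam cr cc ((nu *m map_mx intr (ell U)) 0 0) + hmap x.

(* The graph-directed system below is contractive when [lam] is a Pisot number,
   so this property identifies the family of Rauzy subtiles. *)
Definition is_rauzy zeta (T : A -> set (Kspace R r s)) : Prop :=
  forall a, [/\ T a !=set0, compact (T a)
    & T a = [set x | exists b : A, exists U V : seq A,
                zeta b = U ++ a :: V /\ [set gmap U y | y in T b] x]].

End Rauzy.
End Substitutions.

Definition top_letter (p : nat) : nat := if odd p then (2 * p).-1 else p.-1.

Definition zeta_word (p k : nat) : seq nat :=
  (if odd p then
     if k == 0 then [:: p + 1; p]
     else if k <= p - 2 then [:: p + k + 1]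
     else if k == p - 1 then [:: 0; 2 * p - 1]
     else if k == p then [:: 0; 1]
     else if k <= 2 * p - 2 then [:: k - p + 1]
     else [:: p - 1; p]
   else
     if k == 0 then [:: 2; 0; 1]
     else if k <= p - 3 then [:: k + 2]
     else if k == p - 2 then [:: 0; p - 1]
     else [:: 0; p - 1; 0; 1])%N.

(* For [3 <= p] all the entries of [zeta_word p k] with [k <= top_letter p] are
   at most [top_letter p], so that [inord] is exact. *)
Definition zeta' (p : nat) (k : 'I_(top_letter p).+1) :
    seq 'I_(top_letter p).+1 :=
  map inord (zeta_word p k).

Section Tiles.
Variables (R : realType) (r s : nat) (a b : R).
Variables (cr : r.-tuple R) (cc : s.-tuple R[i]) (F : set (Kspace R r s)).

Let psi_ := psi a cr cc.
Let PsiF (z : R) : set (Kspace R r s) := [set Psi a cr cc z x | x in F].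

Definition X_even (p k : nat) : set (Kspace R r s) :=
  if (k == p.-1)%N then set_sub (psi_ (b ^+ p.-1)) (PsiF (b ^+ p.-1))
  else if odd k then set_sub (psi_ (b ^+ k)) (PsiF (a * b ^+ k))
  else PsiF (a * b ^+ k).

Definition X_three (k : nat) : set (Kspace R r s) :=
  match k with
  | 0%N => PsiF a
  | 1%N => set_sub (psi_ b) (PsiF (a * b))
  | 2%N => PsiF (b ^+ 2)
  | 3%N => set_sub (psi_ a) (PsiF a)
  | 4%N => PsiF (a * b)
  | _ => set_sub (psi_ (b ^+ 2)) (PsiF (b ^+ 2))
  end.

(* Only meaningful for [p = 3] and [p] even. *)
Definition Xtile (p k : nat) : set (Kspace R r s) :=
  if (p == 3)%N then X_three k else X_even p k.

End Tiles.

(* Main.v *)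
(* Since 1/alpha + 1/beta = 1 and alpha^2 = beta^p, the positive numbers
   alpha, beta, beta^2, ..., beta^(p-1) (repeated twice if p is odd) are the
   entries of a left eigenvector of the incidence matrix for beta, resp. beta^2;
   Perron-Frobenius then gives dominance and uniqueness of the eigenvector.
   Write S(c, d) = psi(c) + Psi[d](F).  The tent-tile equation says
   S(c, d) = S(c, d alpha) u S(c + d beta, - d beta).  Every X_k is of the form
   S(c, d), and subdividing it gives the Rauzy system for the opposite of the
   above eigenvector.  As Q(alpha) = Q(lambda), the conjugates of alpha and of
   lambda correspond to each other, so that permuting the coordinates,
   conjugating some complex ones and rescaling by the conjugates of an element
   of Q(lambda) carries the X_k to a solution of the Rauzy system of zeta'_p,
   whose compact non-empty solution is unique. *)
From HB Require Import structures.
Require Import Defs.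
From mathcomp Require Import all_boot all_order all_algebra.
From mathcomp Require Import all_classical all_reals all_analysis.
From mathcomp Require Import complex ring zify.

Set Implicit Arguments.
Unset Strict Implicit.
Unset Printing Implicit Defensive.

Import Order.TTheory GRing.Theory Num.Theory.
Import numFieldNormedType.Exports.

Local Open Scope classical_set_scope.
Local Open Scope ring_scope.

(** * Rational polynomials, conjugates and fields *)

(** No number field or embedding appears as an object. An element of Q(x) is a value f(x) of a
    rational polynomial, and an embedding sending x to y is the statement that every rational
    polynomial vanishing at x vanishes at y ([specializes]). For an algebraic integer this amounts
    to being a Galois conjugate, and it survives a change of generator, which is what comparing
    alpha with lambda requires. The equality Q(alpha) = Q(beta^2) for even p is not formal: it rests
    on alpha = beta^(p/2) = beta^(p/2-1) + 1, where one of two consecutive exponents is even. The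
    two listings of conjugates have unrelated lengths r, s and r', s'. Their equality is obtained by
    counting, from injections of index sets in both directions. Attractors are compared point by
    point: a point of one family is unfolded along a path of the graph, and the same path is
    followed from a point of the other family. *)

Definition evalq (K : numFieldType) (f : {poly rat}) (y : K) : K :=
  (map_poly ratr f).[y].

Section EvalRational.
Variable K : numFieldType.
Implicit Types (f g : {poly rat}) (y : K).

Lemma evalqD f g y : evalq (f + g) y = evalq f y + evalq g y.
Proof. by rewrite /evalq rmorphD hornerD. Qed.

Lemma evalqN f y : evalq (- f) y = - evalq f y.
Proof. by rewrite /evalq rmorphN hornerN. Qed.

Lemma evalqM f g y : evalq (f * g) y = evalq f y * evalq g y.
Proof. by rewrite /evalq rmorphM hornerM. Qed.

Lemma evalqX y : evalq 'X y = y.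
Proof. by rewrite /evalq map_polyX hornerX. Qed.

Lemma evalqC c y : evalq c%:P y = ratr c.
Proof. by rewrite /evalq map_polyC hornerC. Qed.

Lemma evalq_comp f g y : evalq (f \Po g) y = evalq f (evalq g y).
Proof. by rewrite /evalq map_comp_poly horner_comp. Qed.

End EvalRational.

Lemma evalq_rmorph (K L : numFieldType) (h : {rmorphism K -> L}) f (y : K) :
  evalq f (h y) = h (evalq f y).
Proof.
rewrite /evalq -horner_map -map_poly_comp; congr (_.[_]).
by apply: eq_map_poly => c /=; rewrite fmorph_rat.
Qed.

(* [y] is the image of [x] under a field embedding of [rat(x)] in [K]. *)
Definition specializes (K L : numFieldType) (x : K) (y : L) : Prop :=
  forall f, evalq f x = 0 -> evalq f y = 0.

Section Specialization.
Variable R : realType.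
Implicit Types (x y z : R) (f g q : {poly rat}).

Lemma specializes_eq (K L : numFieldType) (x : K) (y : L) f g :
  specializes x y -> evalq f x = evalq g x -> evalq f y = evalq g y.
Proof.
move=> xy e; apply/eqP; rewrite -subr_eq0 -evalqN -evalqD; apply/eqP/xy.
by rewrite evalqD evalqN e subrr.
Qed.

Lemma specializes_evalq (K L : numFieldType) (x : K) (y : L) g :
  specializes x y -> specializes (evalq g x) (evalq g y).
Proof. by move=> xy f; rewrite -!evalq_comp; apply: xy. Qed.

(** The gcd of [q] and [f] still vanishes at [x], so it is not constant and irreducibility makes it
    an associate of [q]. *)
Lemma irreducible_evalq0 q f x :
  irreducible_poly q -> evalq q x = 0 -> evalq f x = 0 -> q %| f.
Proof.
move=> [_ irr] qx fx.
have : root (map_poly ratr (gcdp q f)) x.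
  by rewrite gcdp_map root_gcd; apply/andP; split; apply/rootP.
case: (eqVneq (size (gcdp q f)) 1%N) => [/eqP|] s1.
  case/size_poly1P: s1 => c c0 ->.
  by rewrite map_polyC rootC fmorph_eq0 (negbTE c0).
by move=> _; rewrite -(eqp_dvdl _ (irr _ s1 (dvdp_gcdl _ _))) dvdp_gcdr.
Qed.

Lemma galois_conjugate_specializes x (z : R[i]) :
  galois_conjugate x z -> specializes x z.
Proof.
move=> [q [_ irr /rootP qx /rootP qz]] f /(irreducible_evalq0 irr qx).
by case/dvdpP => g ->; rewrite evalqM /evalq qz mulr0.
Qed.

Lemma algebraic_integer_evalq x :
  algebraic_integer x -> exists2 f, f != 0 & evalq f x = 0.
Proof.
case=> p pm px; exists (map_poly intr p).
  rewrite -lead_coef_eq0 lead_coef_map_inj //; last exact: intr_inj.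
  by rewrite (monicP pm) oner_eq0.
move: px; rewrite /evalq -map_poly_comp => /rootP <-; congr (_.[_]).
by apply: eq_map_poly => c /=; rewrite ratr_int.
Qed.

(** A polynomial of least size vanishing at [x] is irreducible: in a factorization one factor
    vanishes at [x], so by minimality it has full size and the other is constant. *)
Lemma algebraic_minimal x f : f != 0 -> evalq f x = 0 ->
  exists q, [/\ q \is monic, irreducible_poly q & evalq q x = 0].
Proof.
move=> f0 fx.
pose P n := `[< exists g, [/\ g != 0, evalq g x = 0 & size g = n] >].
have exP : exists n, P n by exists (size f); apply/asboolP; exists f.
case: (ex_minnP exP) => n /asboolP [g [g0 gx sg]] nmin.
exists ((lead_coef g)^-1 *: g).
have lg0 : (lead_coef g)^-1 != 0 by rewrite invr_eq0 lead_coef_eq0.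
split.
- by rewrite monicE lead_coefZ mulVf // lead_coef_eq0.
- split.
    rewrite size_scale // ltnNge; apply/negP => /size1_polyC e.
    move: gx g0; rewrite e evalqC => /eqP; rewrite fmorph_eq0 => /eqP ->.
    by rewrite eqxx.
  move=> d sd /dvdpP [h]; move/(canRL (scalerK lg0)); rewrite invrK => gE.
  have gdh : d * h %= g.
    by rewrite eqp_sym gE mulrC eqp_scale // lead_coef_eq0.
  have /andP [d0 h0] : (d != 0) && (h != 0).
    by rewrite -negb_or -mulf_eq0 -size_poly_eq0 (eqp_size gdh) size_poly_eq0.
  have sgE : size g = (size d + size h).-1 by rewrite -(eqp_size gdh) size_mul.
  have : evalq d x * evalq h x = 0.
    move/eqP: gx; rewrite gE -mul_polyC !evalqM evalqC mulf_eq0 fmorph_eq0.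
    by rewrite lead_coef_eq0 (negbTE g0) mulrC => /eqP.
  move/eqP; rewrite mulf_eq0 => /orP [] /eqP e0.
    have : (n <= size d)%N by apply: nmin; apply/asboolP; exists d.
    rewrite -sg sgE => le_n.
    have sh : size h = 1%N.
      by move: h0 d0; rewrite -!size_poly_gt0; move: le_n sd; lia.
    apply: (@eqp_trans _ g); last by rewrite eqp_sym eqp_scale.
    apply: eqp_trans gdh; case/size_poly1P: (introT eqP sh) => c c0 ->.
    by rewrite mulrC mul_polyC eqp_sym eqp_scale.
  have : (n <= size h)%N by apply: nmin; apply/asboolP; exists h.
  rewrite -sg sgE => le_n.
  by move: h0 d0 sd; rewrite -!size_poly_gt0; move: le_n; lia.
- by rewrite -mul_polyC evalqM gx mulr0.
Qed.

(** Converse of [galois_conjugate_specializes]: from here on conjugates are handled through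
    [specializes], without their minimal polynomial. *)
Lemma specializes_galois_conjugate x (z : R[i]) :
  algebraic_integer x -> specializes x z -> galois_conjugate x z.
Proof.
move=> /algebraic_integer_evalq [f f0 fx] xz.
have [q [qm qi qx]] := algebraic_minimal f0 fx.
by exists q; split=> //; apply/rootP; rewrite ?qx //; apply: xz.
Qed.

Lemma in_fieldD x y z : in_field x y -> in_field x z -> in_field x (y + z).
Proof. by move=> [f <-] [g <-]; exists (f + g); rewrite -!/(evalq _ _) evalqD. Qed.

Lemma in_fieldN x y : in_field x y -> in_field x (- y).
Proof. by move=> [f <-]; exists (- f); rewrite -!/(evalq _ _) evalqN. Qed.

Lemma in_fieldB x y z : in_field x y -> in_field x z -> in_field x (y - z).
Proof. by move=> xy xz; apply: in_fieldD => //; apply: in_fieldN. Qed.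

Lemma in_fieldM x y z : in_field x y -> in_field x z -> in_field x (y * z).
Proof. by move=> [f <-] [g <-]; exists (f * g); rewrite -!/(evalq _ _) evalqM. Qed.

Lemma in_field_id x : in_field x x.
Proof. by exists 'X; rewrite -/(evalq _ _) evalqX. Qed.

Lemma in_field_rat x c : in_field x (ratr c).
Proof. by exists c%:P; rewrite -/(evalq _ _) evalqC. Qed.

Lemma in_field0 x : in_field x 0.
Proof. by rewrite -(rmorph0 (@ratr R)); apply: in_field_rat. Qed.

Lemma in_field1 x : in_field x 1.
Proof. by rewrite -(rmorph1 (@ratr R)); apply: in_field_rat. Qed.

Lemma in_fieldX x y n : in_field x y -> in_field x (y ^+ n).
Proof.
move=> xy; elim: n => [|n IH]; first exact: in_field1.
by rewrite exprS; apply: in_fieldM.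
Qed.

Lemma in_field_trans y x z : in_field x y -> in_field y z -> in_field x z.
Proof. by move=> [f <-] [g <-]; exists (g \Po f); apply: evalq_comp. Qed.

(** Bezout with the minimal polynomial [q] of [x]: if u q + v f = 1 then v(x) is the inverse of
    f(x). The inverse of 0 is 0, which also lies in the field. *)
Lemma in_fieldV x y : algebraic_integer x -> in_field x y -> in_field x y^-1.
Proof.
move=> /algebraic_integer_evalq [h h0 hx] [f <-]; rewrite -/(evalq f x).
have [q [_ qi qx]] := algebraic_minimal h0 hx.
case: (eqVneq (evalq f x) 0) => [->|fx]; first by rewrite invr0; apply: in_field0.
have /Bezout_eq1_coprimepP [[u v] /= uv] : coprimep q f.
  have [_ irr] := qi; apply: contraT; rewrite /coprimep => s1.
  have qg : q %| gcdp q f by rewrite -(eqp_dvdl _ (irr _ s1 (dvdp_gcdl _ _))).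
  have /dvdpP [k kE] := dvdp_trans qg (dvdp_gcdr _ _).
  by move: fx; rewrite kE evalqM qx mulr0 eqxx.
exists v; apply: (mulIf fx); rewrite mulVf // -/(evalq v x) -evalqM.
have : evalq (u * q) x + evalq (v * f) x = 1.
  by rewrite -evalqD uv evalqC rmorph1.
by rewrite (evalqM u) qx mulr0 add0r => ->.
Qed.

(** Specialization makes the value independent of the chosen polynomial, so [xget] returns it and
    not its default 0. *)
Lemma field_image_evalq (K : numFieldType) x (y : K) f :
  specializes x y -> field_image x y (evalq f x) = evalq f y.
Proof.
move=> xy; rewrite /field_image; apply: xget_unique; first by exists f.
by move=> w [q [qx <-]]; apply: (specializes_eq xy).
Qed.

Section FieldImage.
Variables (K : numFieldType) (x : R) (y : K).
Hypothesis xy : specializes x y.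

Lemma field_imageD u v : in_field x u -> in_field x v ->
  field_image x y (u + v) = field_image x y u + field_image x y v.
Proof.
by move=> [f <-] [g <-]; rewrite -evalqD !field_image_evalq // evalqD.
Qed.

Lemma field_imageM u v : in_field x u -> in_field x v ->
  field_image x y (u * v) = field_image x y u * field_image x y v.
Proof.
by move=> [f <-] [g <-]; rewrite -evalqM !field_image_evalq // evalqM.
Qed.

Lemma field_imageN u : in_field x u ->
  field_image x y (- u) = - field_image x y u.
Proof. by move=> [f <-]; rewrite -evalqN !field_image_evalq // evalqN. Qed.

Lemma field_image_id : field_image x y x = y.
Proof. by rewrite -{2}(evalqX x) field_image_evalq // evalqX. Qed.

Lemma field_image_rat c : field_image x y (ratr c) = ratr c.
Proof. by rewrite -(evalqC c x) field_image_evalq // evalqC. Qed.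

Lemma field_image_neq0 u : algebraic_integer x -> in_field x u -> u != 0 ->
  field_image x y u != 0.
Proof.
move=> ax xu u0; have xv := in_fieldV ax xu.
apply/eqP => e; have := field_imageM xu xv.
rewrite divff // e mul0r -(rmorph1 (@ratr R)) field_image_rat rmorph1 => /eqP.
by rewrite oner_eq0.
Qed.

End FieldImage.

(** The embedding of Q(y) sending y to g(w) is the restriction to Q(y) of the embedding of Q(x)
    sending x to w. *)
Lemma field_image_trans (K : numFieldType) x y g (w : K) u :
  y = evalq g x -> specializes x w -> in_field y u ->
  field_image y (evalq g w) u = field_image x w u.
Proof.
move=> -> xw [f <-]; rewrite -!/(evalq _ _).
rewrite field_image_evalq; last exact: specializes_evalq.
by rewrite -!evalq_comp field_image_evalq.
Qed.

End Specialization.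

(** * Perron-Frobenius *)

(** The norm of [R[i]] takes its values in [R[i]]; this is the same modulus as an element of [R],
    where maxima and limits are taken. *)
Definition cabs (R : realType) (z : R[i]) : R := complex.Re `|z|.

Lemma cabsE (R : realType) (z : R[i]) : (cabs z)%:C%C = `|z|.
Proof. by rewrite /cabs RRe_real // normr_real. Qed.

Lemma cabs_real (R : realType) (t : R) : cabs t%:C%C = `|t|.
Proof.
by apply: (@complexI R); rewrite cabsE normc_def /= expr0n addr0 sqrtr_sqr.
Qed.

Section PerronFrobenius.
Variables (m : nat) (zeta : 'I_m.+1 -> seq 'I_m.+1).

Lemma sum_seq_count (K : pzRingType) (w : 'I_m.+1 -> K) s :
  \sum_(x <- s) w x = \sum_i w i * (count_mem i s)%:R.
Proof.
elim: s => [|a s IH].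
  by rewrite big_nil big1 // => i _; rewrite mulr0.
rewrite big_cons IH.
under [RHS]eq_bigr => i _ do rewrite /= natrD mulrDr.
rewrite big_split /=; congr (_ + _).
rewrite (bigD1 a) //= eqxx mulr1 big1 ?addr0 // => i.
by rewrite eq_sym => /negbTE ->; rewrite mulr0.
Qed.

Lemma mul_ell (K : pzRingType) (w : 'rV[K]_m.+1) s :
  (w *m map_mx intr (ell s)) 0 0 = \sum_(x <- s) w 0 x.
Proof. by rewrite sum_seq_count !mxE; apply: eq_bigr => i _; rewrite !mxE. Qed.

Lemma mul_incidence (K : pzRingType) (w : 'rV[K]_m.+1) j :
  (w *m map_mx intr (incidence zeta)) 0 j = \sum_(x <- zeta j) w 0 x.
Proof. by rewrite sum_seq_count !mxE; apply: eq_bigr => i _; rewrite !mxE. Qed.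

(** A left eigenvector is an additive weight on words that [zeta] multiplies by [mu]; in this form
    it iterates along words, without powers of the matrix. *)
Lemma mul_incidence_eq (K : pzRingType) (w : 'rV[K]_m.+1) mu :
  w *m map_mx intr (incidence zeta) = mu *: w <->
  forall j, \sum_(x <- zeta j) w 0 x = mu * w 0 j.
Proof.
split=> [e j|e]; first by rewrite -mul_incidence e mxE.
by apply/rowP => j; rewrite mul_incidence e mxE.
Qed.

Lemma sum_subst_iter (K : comPzRingType) (w : 'I_m.+1 -> K) mu :
  (forall j, \sum_(x <- zeta j) w x = mu * w j) ->
  forall k j, \sum_(x <- iter k (subst_ext zeta) [:: j]) w x = mu ^+ k * w j.
Proof.
move=> e; elim=> [|k IH] j; first by rewrite /= big_seq1 expr0 mul1r.
rewrite iterS {1}/subst_ext big_flatten /= big_map.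
under eq_bigr => i _ do rewrite e.
by rewrite -big_distrr IH /= exprS mulrA.
Qed.

Variables (R : realType) (lam : R) (v : 'I_m.+1 -> R).
Hypotheses (prim : primitive_subst zeta) (lam0 : 0 < lam).
Hypotheses (v0 : forall j, 0 < v j)
  (vE : forall j, \sum_(x <- zeta j) v x = lam * v j).

(** Take the letter [j0] maximizing |w_j| / v_j, with maximum c. Weighing the k-th image of [j0] by
    [w], bounded letterwise by c v, gives |mu|^k |w_j0| <= lam^k |w_j0|. In the case of equality
    both the triangle inequality and every letterwise bound are equalities. *)
Lemma perron_frobenius (mu : R[i]) (w : 'I_m.+1 -> R[i]) :
  (exists j, w j != 0) -> (forall j, \sum_(x <- zeta j) w x = mu * w j) ->
  `|mu| <= lam%:C%C /\
  (`|mu| = lam%:C%C -> exists t, forall j, w j = t * (v j)%:C%C).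
Proof.
move=> [j1 wj1] wE; have [k k0 pk] := prim.
pose q j := cabs (w j) / v j.
have [j0 _ jmax] := @arg_maxP _ _ _ ord0 xpredT q isT.
set c := q j0 in jmax.
have wc j : `|w j| <= (c * v j)%:C%C.
  by rewrite -cabsE lecR -ler_pdivrMr //; apply: jmax.
have wj0 : `|w j0| = (c * v j0)%:C%C by rewrite -cabsE /c /q mulfVK // gt_eqF.
have c0 : 0 < c.
  have : 0 < (c * v j1)%:C%C by apply: lt_le_trans (wc j1); rewrite normr_gt0.
  by rewrite ltcR pmulr_lgt0.
pose s := iter k (subst_ext zeta) [:: j0].
pose P i : nat := count_mem i s.
(* By primitivity every letter occurs in [s], so the equality case gives information on every
   coordinate of [w]. *)
have P0 i : (0 < P i)%N by have := pk j0 i; rewrite mxE ltz_nat.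
have PC i : 0 < (P i)%:R :> R[i] by rewrite ltr0n.
have sw : \sum_i w i * (P i)%:R = mu ^+ k * w j0.
  by rewrite -sum_seq_count (sum_subst_iter wE).
have sv : \sum_i v i * (P i)%:R = lam ^+ k * v j0.
  by rewrite -sum_seq_count (sum_subst_iter vE).
have up : \sum_i `|w i * (P i)%:R| <= \sum_i (c * v i)%:C%C * (P i)%:R.
  by apply: ler_sum => i _; rewrite normrM normr_nat ler_wpM2r // ltW.
have upE : \sum_i (c * v i)%:C%C * (P i)%:R = (lam ^+ k)%:C%C * `|w j0|.
  rewrite wj0 -rmorphM mulrCA -sv mulr_sumr rmorph_sum.
  by apply: eq_bigr => i _; rewrite mulrA !rmorphM rmorph_nat.
have wj0_gt0 : 0 < `|w j0| by rewrite wj0 ltcR mulr_gt0.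
have low : `|\sum_i w i * (P i)%:R| = `|mu| ^+ k * `|w j0|.
  by rewrite sw normrM normrX.
split.
  have : `|mu| ^+ k * `|w j0| <= (lam ^+ k)%:C%C * `|w j0|.
    by rewrite -low -upE (le_trans _ up) // ler_norm_sum.
  by rewrite ler_pM2r // rmorphXn /= ler_pXn2r // nnegrE ?normr_ge0 ?ler0c ?ltW.
move=> muE.
have lowup : `|\sum_i w i * (P i)%:R| = \sum_i (c * v i)%:C%C * (P i)%:R.
  by rewrite low upE muE rmorphXn.
have eq1 : `|\sum_i w i * (P i)%:R| = \sum_i `|w i * (P i)%:R|.
  by apply/le_anti; rewrite ler_norm_sum lowup up.
(* Equality in the triangle inequality: all terms have the same phase [t]. *)
have [t _ tE] := normC_sum_eq eq1.
have wcE i : `|w i| = (c * v i)%:C%C.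
  have : \sum_i ((c * v i)%:C%C * (P i)%:R - `|w i * (P i)%:R|) == 0.
    by rewrite sumrB -lowup eq1 subrr.
  rewrite psumr_eq0 => [|l _]; last first.
    by rewrite subr_ge0 normrM normr_nat ler_wpM2r // ltW.
  move=> /allP /(_ i (mem_index_enum _)).
  by rewrite subr_eq0 normrM normr_nat (inj_eq (mulIf (lt0r_neq0 (PC i)))) => /eqP.
exists (t * c%:C%C) => j; apply: (mulIf (lt0r_neq0 (PC j))).
by rewrite tE // normrM normr_nat wcE rmorphM; ring.
Qed.

(** An eigenvalue of modulus [lam] has an eigenvector proportional to [v], hence equals [lam]. *)
Lemma positive_dominant_root : dominant_root zeta lam.
Proof.
split=> //.
  apply/eigenvalueP; exists (\row_j v j).
    by apply/mul_incidence_eq => j; under eq_bigr do rewrite mxE; rewrite mxE vE.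
  by apply/eqP => /rowP /(_ ord0); rewrite !mxE => /eqP; rewrite gt_eqF.
move=> mu /eigenvalueP [w /mul_incidence_eq wE w0] mul.
have wj : exists j, w 0 j != 0.
  apply: contrapT => h; move/eqP: w0; apply; apply/rowP => j; rewrite mxE.
  by apply: contrapT => /eqP wj; apply: h; exists j.
have [le_mu eq_mu] := perron_frobenius wj wE.
rewrite lt_neqAle le_mu andbT; apply: contraNneq mul => /eq_mu [t tE].
have [j wj0] := wj; apply/eqP/(mulIf wj0); rewrite -wE tE mulrCA -rmorphM -vE.
by rewrite rmorph_sum mulr_sumr; apply: eq_bigr.
Qed.

(** Case [mu = lam] of [perron_frobenius]. Proportionality to [v] is written as a cross product,
    which covers the zero vector too. *)
Lemma eigenvector_unique (u : 'I_m.+1 -> R) :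
  (forall j, \sum_(x <- zeta j) u x = lam * u j) ->
  forall i j, u i * v j = u j * v i.
Proof.
move=> uE i j; case: (pselect (exists l, u l != 0)) => [[l ul]|h]; last first.
  have u0 l : u l = 0 by apply: contrapT => /eqP ul; apply: h; exists l.
  by rewrite !u0 !mul0r.
have wE l0 : \sum_(x <- zeta l0) (u x)%:C%C = lam%:C%C * (u l0)%:C%C.
  by rewrite -rmorphM -uE rmorph_sum.
have [|_ []] := @perron_frobenius lam%:C%C (fun x => (u x)%:C%C) _ wE.
- by exists l; rewrite fmorph_eq0.
- by rewrite ger0_norm // ler0c ltW.
move=> t tE; apply: (@complexI R).
by rewrite !rmorphM /= !tE; ring.
Qed.

End PerronFrobenius.

(** * The substitution zeta' *)

Section ReachableLetters.
Variables (m : nat) (zeta : 'I_m.+1 -> seq 'I_m.+1).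

Lemma mem_iter_subst k s c :
  c \in iter k (subst_ext zeta) s =
  has (fun b => c \in iter k (subst_ext zeta) [:: b]) s.
Proof.
have ext1 b : subst_ext zeta [:: b] = zeta b by rewrite /subst_ext /= cats0.
elim: k s => [|k IH] s.
  by rewrite /=; elim: s => //= a s IHs; rewrite in_cons IHs mem_seq1.
rewrite iterSr IH; under [RHS]eq_has => b do rewrite iterSr IH ext1.
by rewrite /subst_ext; elim: s => //= a s IHs; rewrite has_cat IHs.
Qed.

Definition reaches k x y :=
  inord y \in iter k (subst_ext zeta) [:: inord x : 'I_m.+1].

Lemma reaches_trans k l x y z :
  reaches k x y -> reaches l y z -> reaches (k + l) x z.
Proof.
move=> xy yz; rewrite /reaches addnC iterD mem_iter_subst.
by apply/hasP; exists (inord y).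
Qed.

Lemma reaches0 x : reaches 0 x x.
Proof. by rewrite /reaches /= mem_head. Qed.

(** Primitivity asks for one exponent valid for all pairs of letters. Going through 0, the different
    lengths of the two outer walks are evened out by a closed walk at 0, of any length from [L]
    on. *)
Lemma primitive_of_reaches L B :
  (forall l, (L <= l)%N -> reaches l 0 0) ->
  (forall x, (x <= m)%N -> exists2 l, (l <= B)%N & reaches l x 0) ->
  (forall y, (y <= m)%N -> exists2 l, (l <= B)%N & reaches l 0 y) ->
  primitive_subst zeta.
Proof.
move=> loop to0 from0; exists (2 * B + L).+1 => // a b.
have [l1 l1B a0] := to0 _ (leq_ord a); have [l2 l2B b0] := from0 _ (leq_ord b).
have : reaches (2 * B + L).+1 a b.
  have -> : (2 * B + L).+1 = (l1 + ((2 * B + L).+1 - l1 - l2) + l2)%N by lia.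
  by apply: reaches_trans b0; apply: reaches_trans a0 _; apply: loop; lia.
by rewrite /reaches !inord_val !mxE ltz_nat -has_count has_pred1.
Qed.

Definition in_incidence_image (v : 'cV[int]_m.+1) :=
  exists u, incidence zeta *m u = v.

Lemma in_incidence_imageB v w :
  in_incidence_image v -> in_incidence_image w -> in_incidence_image (v - w).
Proof. by move=> [u <-] [u' <-]; exists (u - u'); rewrite mulmxBr. Qed.

(** Integral preimages of the unit vectors form a right inverse with integer entries, so the
    determinant is a unit of the integers. *)
Lemma unimodular_of_image :
  (forall i, in_incidence_image (delta_mx i 0)) -> unimodular zeta.
Proof.
move=> /choice [u uE].
have : incidence zeta *m (\matrix_(i, j) u j i 0) = 1%:M.
  apply/matrixP => i j; have /colP /(_ i) := uE j.
  rewrite !mxE andbT => <-; by apply: eq_bigr => l _; rewrite !mxE.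
move=> /(congr1 (fun A => \det A)); rewrite det_mulmx det1 => e.
have : \det (incidence zeta) \is a GRing.unit.
  by apply/unitrP; eexists; split; last exact: e; rewrite mulrC.
by move=> /orP [] /eqP dE; [left|right].
Qed.

End ReachableLetters.

Section ZetaPrime.
Variable p : nat.
Hypothesis hp : (3 <= p)%N.
Let top := top_letter p.
Let top_odd : odd p -> top = (2 * p).-1.
Proof. by rewrite /top /top_letter => ->. Qed.
Let top_even : ~~ odd p -> top = p.-1.
Proof. by rewrite /top /top_letter => /negbTE ->. Qed.

Lemma zeta_word_top k x : (k <= top)%N -> x \in zeta_word p k -> (x <= top)%N.
Proof.
rewrite /zeta_word; case: ifPn => o; rewrite ?(top_odd o) ?(top_even o) => kt;
  do ![case: ifPn => ?]; rewrite !inE; lia.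
Qed.

Lemma val_zeta' (k : 'I_top.+1) : map val (zeta' k) = zeta_word p k.
Proof.
rewrite /zeta' -map_comp -[RHS]map_id; apply/eq_in_map => x xk /=.
by rewrite inordK // ltnS (zeta_word_top _ xk) // leq_ord.
Qed.

Lemma sum_zeta' (V : nmodType) (w : nat -> V) (k : 'I_top.+1) :
  \sum_(x <- zeta' k) w x = \sum_(x <- zeta_word p k) w x.
Proof. by rewrite -(val_zeta' k) [RHS]big_map. Qed.

Lemma zeta'_nonerasing : nonerasing (@zeta' p).
Proof.
move=> k; rewrite -size_eq0 size_map /zeta_word.
by do ![case: ifP => ?].
Qed.

Lemma reaches1 x y : (x <= top)%N -> y \in zeta_word p x -> reaches (@zeta' p) 1 x y.
Proof.
move=> xt yx; rewrite /reaches /= /subst_ext /= cats0.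
by rewrite /zeta' inordK ?ltnS // map_f.
Qed.

(** The image of 0 contains 0, which gives closed walks of all lengths. The steps from x to x+2,
    starting at 0 or at 1, visit every letter and end at [p-2] or [p-1], whose images contain 0. *)
Lemma zeta'_primitive_even : ~~ odd p -> primitive_subst (@zeta' p).
Proof.
move=> o; have tE := top_even o.
have st x y : (x < p)%N -> y \in zeta_word p x -> reaches (@zeta' p) 1 x y.
  by move=> xp; apply: reaches1; lia.
have wE : zeta_word p =1 fun k => if k == 0%N then [:: 2; 0; 1]%N
    else if (k <= p - 3)%N then [:: k + 2]%N
    else if k == (p - 2)%N then [:: 0; p - 1]%N else [:: 0; p - 1; 0; 1]%N.
  by move=> k; rewrite /zeta_word (negbTE o).
have r00 : reaches (@zeta' p) 1 0 0 by apply: st; [lia|rewrite wE].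
have r2 x : (x + 2 < p)%N -> reaches (@zeta' p) 1 x (x + 2).
  move=> xp; apply: st; first lia.
  by rewrite wE; case: eqP => [->|?] //; rewrite ifT ?inE //; lia.
have rp x : (x < p)%N -> (p <= x + 2)%N -> reaches (@zeta' p) 1 x 0.
  move=> xp px; apply: st => //; rewrite wE.
  do ![case: ifPn => ?]; rewrite ?inE //; lia.
apply: (@primitive_of_reaches _ _ 0 p).
- elim=> [|l IH] _; first exact: reaches0.
  by rewrite -addn1; apply: reaches_trans r00; apply: IH.
- move=> x xt; have {xt} xp : (x < p)%N by move: xt; rewrite -/top tE; lia.
  suff [l lp rl] : exists2 l, (l <= p - x)%N & reaches (@zeta' p) l x 0.
    by exists l => //; lia.
  have [n] : exists n, (p - x <= n)%N by exists (p - x)%N.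
  elim: n x xp => [|n IH] x xp xn; first lia.
  case: (ltnP (x + 2) p) => x2; last by exists 1%N; [lia | apply: rp; lia].
  have [| |l lp rl] := IH (x + 2)%N; [lia.. |].
  by exists (1 + l)%N; [lia | apply: reaches_trans rl; apply: r2].
- move=> y yt; have {yt} yp : (y < p)%N by move: yt; rewrite -/top tE; lia.
  suff [l lp rl] : exists2 l, (l <= y.+1)%N & reaches (@zeta' p) l 0 y.
    by exists l => //; lia.
  have [n] : exists n, (y <= n)%N by exists y.
  elim: n y yp => [|n IH] y yp yn.
    by exists 0%N => //; rewrite (_ : y = 0%N); [apply: reaches0 | lia].
  case: y yp yn => [|[|y]] yp yn.
  + by exists 0%N => //; apply: reaches0.
  + by exists 1%N => //; apply: st; [lia|rewrite wE].
  + have [| |l lp rl] := IH y; [lia.. |].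
    exists (l + 1)%N; first lia.
    by apply: reaches_trans rl _; rewrite -addn2; apply: r2; lia.
Qed.

(* From [0] the letters are visited along [0, p+1, 2, p+3, ..., p-1, 0], a cycle
   of odd length [p], and [0, p, 0] is a cycle of length [2]. *)
Lemma zeta'_primitive_odd : odd p -> primitive_subst (@zeta' p).
Proof.
move=> o; have tE := top_odd o.
have st x y : (x < 2 * p)%N -> y \in zeta_word p x -> reaches (@zeta' p) 1 x y.
  by move=> xp; apply: reaches1; lia.
(* Two chains partition the letters: 0, p+1, 2, p+3, ..., p-1 for [e = false], and p, 1, p+2, 3,
   ..., 2p-1 for [e = true]. The first returns to 0 in one step, the second in two steps through
   p. *)
pose ch e t := (if odd t (+) e then p + t else t)%N.
have wE : zeta_word p =1 fun k =>
    (if k == 0 then [:: p + 1; p]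
     else if k <= p - 2 then [:: p + k + 1]
     else if k == p - 1 then [:: 0; 2 * p - 1]
     else if k == p then [:: 0; 1]
     else if k <= 2 * p - 2 then [:: k - p + 1]
     else [:: p - 1; p])%N.
  by move=> k; rewrite /zeta_word o.
have step e t : (t.+1 < p)%N -> reaches (@zeta' p) 1 (ch e t) (ch e t.+1).
  move=> tp; apply: st; first by rewrite /ch; case: ifP; lia.
  rewrite wE /ch /=; case: e; case: (boolP (odd t)) => ot /=;
    do ![case: ifPn => ?]; rewrite !inE; lia.
have steps e t j : (t + j < p)%N -> reaches (@zeta' p) j (ch e t) (ch e (t + j)%N).
  elim: j => [|j IH] tj; first by rewrite addn0; apply: reaches0.
  rewrite -[j.+1]addn1; apply: (@reaches_trans _ _ _ _ _ (ch e (t + j)%N)).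
    by apply: IH; lia.
  by rewrite addn1 addnS; apply: step; lia.
have r0p : reaches (@zeta' p) 1 0 p by apply: st; [lia|rewrite wE !inE; lia].
have rp0 : reaches (@zeta' p) 1 p 0.
  by apply: st; [lia | rewrite wE; do ![case: ifPn => ?]; rewrite !inE; lia].
have r200 : reaches (@zeta' p) 2 0 0 by apply: reaches_trans r0p rp0.
have chF0 : ch false 0 = 0%N by [].
have chT0 : ch true 0 = p by rewrite /ch /= addn0.
have chFp : ch false p.-1 = p.-1 by rewrite /ch addbF ifN //; lia.
have chTp : ch true p.-1 = (p + p.-1)%N by rewrite /ch addbT ifT //; lia.
have toF t : (t < p)%N -> reaches (@zeta' p) (p - t) (ch false t) 0.
  move=> tp; have -> : (p - t = (p - t.+1) + 1)%N by lia.
  apply: (@reaches_trans _ _ _ _ _ (ch false p.-1)).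
    have := steps false t (p - t.+1)%N.
    by rewrite (_ : t + (p - t.+1) = p.-1)%N; [apply|]; lia.
  rewrite chFp; apply: st; first lia.
  by rewrite wE; do ![case: ifPn => ?]; rewrite !inE; lia.
have toT t : (t < p)%N -> reaches (@zeta' p) (p.+1 - t) (ch true t) 0.
  move=> tp; have -> : (p.+1 - t = (p - t.+1) + 1 + 1)%N by lia.
  apply: reaches_trans rp0.
  apply: (@reaches_trans _ _ _ _ _ (ch true p.-1)).
    have := steps true t (p - t.+1)%N.
    by rewrite (_ : t + (p - t.+1) = p.-1)%N; [apply|]; lia.
  rewrite chTp; apply: st; first lia.
  by rewrite wE; do ![case: ifPn => ?]; rewrite !inE; lia.
have chE x : (x <= top)%N -> exists e, exists2 t, (t < p)%N & x = ch e t.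
  move=> xt; case: (ltnP x p) => xp.
    by exists (odd x), x => //; rewrite /ch addbb.
  exists (~~ odd (x - p)%N), (x - p)%N; first lia.
  by rewrite /ch addbN addbb subnKC.
have ev l : reaches (@zeta' p) (l.*2) 0 0.
  elim: l => [|l IH]; first exact: reaches0.
  by rewrite doubleS -addn2; apply: reaches_trans r200.
apply: (@primitive_of_reaches _ _ p p.+1).
- move=> l pl; case: (boolP (odd l)) => ol; last first.
    by rewrite -(even_halfK ol); apply: ev.
  have -> : l = (p + (l - p)./2.*2)%N by rewrite even_halfK; lia.
  apply: reaches_trans (ev _).
  by have := toF 0%N; rewrite chF0 subn0; apply; lia.
- move=> x /chE [[] [t tp ->]].
    by exists (p.+1 - t)%N; [lia|apply: toT].
  by exists (p - t)%N; [lia|apply: toF].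
- move=> x /chE [[] [t tp ->]].
    exists (1 + t)%N; first lia.
    by have := steps true 0%N t tp; rewrite chT0; apply: reaches_trans r0p.
  by exists t; [lia|apply: (steps false 0%N)].
Qed.

Lemma zeta'_primitive : primitive_subst (@zeta' p).
Proof.
case: (boolP (odd p)) => o; first exact: zeta'_primitive_odd.
exact: zeta'_primitive_even.
Qed.

(** Elimination on columns: letters with one-letter images yield most unit vectors at once, and
    subtracting these from the remaining columns isolates the others one by one. *)
Lemma zeta'_unimodular : unimodular (@zeta' p).
Proof.
pose e x : 'cV[int]_top.+1 := delta_mx (inord x) 0.
pose im := in_incidence_image (@zeta' p).
have imB v w : im v -> im w -> im (v - w) by apply: in_incidence_imageB.
have imw k : (k <= top)%N -> im (\sum_(x <- zeta_word p k) e x).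
  move=> kt; exists (delta_mx (inord k) 0).
  rewrite -colE -[k in RHS](@inordK top) // -sum_zeta'.
  apply/colP => i; rewrite !mxE summxE.
  have -> : (count_mem i (zeta' (inord k)) : int) =
      \sum_(x <- zeta' (inord k)) (x == i)%:R.
    by elim: (zeta' _) => [|a s IH]; rewrite ?big_nil // big_cons -IH /= PoszD natz.
  by apply: eq_bigr => x _; rewrite !mxE andbT inord_val eq_sym.
suff ime x : (x <= top)%N -> im (e x).
  by apply: unimodular_of_image => i; have := ime _ (leq_ord i); rewrite /e inord_val.
rewrite /top; case: (boolP (odd p)) => o.
- have tE := top_odd o; rewrite -/top tE.
  have wE k : (k <= (2 * p).-1)%N -> im (\sum_(x <-
    (if k == 0 then [:: p + 1; p]
     else if k <= p - 2 then [:: p + k + 1]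
     else if k == p - 1 then [:: 0; 2 * p - 1]
     else if k == p then [:: 0; 1]
     else if k <= 2 * p - 2 then [:: k - p + 1]
     else [:: p - 1; p])%N) e x).
    by move=> kt; move: (imw k); rewrite /zeta_word o; apply; rewrite tE.
  have i1 k : (p.+2 <= k < 2 * p)%N -> im (e k).
    move=> hk; have := wE (k - p.+1)%N ltac:(lia).
    rewrite ifF ?ifT ?big_seq1; [|lia..].
    by have -> : (p + (k - p.+1) + 1)%N = k by lia.
  have i2 k : (2 <= k < p)%N -> im (e k).
    move=> hk; have := wE (p + k.-1)%N ltac:(lia).
    do 4?[rewrite ifF; last lia]; rewrite ifT ?big_seq1; [|lia..].
    by have -> : (p + k.-1 - p + 1)%N = k by lia.
  have i0 : im (e 0%N).
    have := wE p.-1%N ltac:(lia).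
    do 2?[rewrite ifF; last lia]; rewrite ifT; last lia.
    rewrite !big_cons big_nil addr0 => /imB /(_ (i1 (2 * p - 1)%N ltac:(lia))).
    by rewrite addrK.
  have i3 : im (e 1%N).
    have := wE p%N ltac:(lia).
    do 3?[rewrite ifF; last lia]; rewrite ifT; last lia.
    by rewrite !big_cons big_nil addr0 => /imB /(_ i0); rewrite addrC addKr.
  have i4 : im (e p).
    have := wE (2 * p).-1%N ltac:(lia).
    do 5?[rewrite ifF; last lia].
    rewrite !big_cons big_nil addr0 => /imB /(_ (i2 (p - 1)%N ltac:(lia))).
    by rewrite addrC addKr.
  have i5 : im (e (p + 1)%N).
    have := wE 0%N ltac:(lia).
    rewrite !big_cons big_nil addr0 => /imB /(_ i4).
    by rewrite addrK.
  move=> xt; case: (ltnP x p) => xp.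
    by case: x xp {xt} => [|[|x]] xp //; apply: i2.
  case: (ltngtP x p) xp => // [{}xp _|-> //].
  case: (ltngtP x (p + 1)%N) => // [|xp1|-> //]; first lia.
  by apply: i1; lia.
- have tE := top_even o; rewrite -/top tE.
  have wE k : (k <= p.-1)%N -> im (\sum_(x <-
    (if k == 0 then [:: 2; 0; 1]
     else if k <= p - 3 then [:: k + 2]
     else if k == p - 2 then [:: 0; p - 1]
     else [:: 0; p - 1; 0; 1])%N) e x).
    by move=> kt; move: (imw k); rewrite /zeta_word (negbTE o); apply; rewrite tE.
  have p4 : (4 <= p)%N by lia.
  have i1 k : (3 <= k < p)%N -> im (e k).
    move=> hk; have := wE (k - 2)%N ltac:(lia).
    rewrite ifF ?ifT ?big_seq1; [|lia..].
    by have -> : (k - 2 + 2)%N = k by lia.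
  have := wE (p - 2)%N ltac:(lia).
  do 2?[rewrite ifF; last lia]; rewrite ifT; last lia.
  rewrite !big_cons big_nil addr0 => i0'.
  have i0 : im (e 0%N).
    by have := imB _ _ i0' (i1 (p - 1)%N ltac:(lia)); rewrite addrK.
  (* The image of [p-1] is that of [p-2] followed by the word 0 1. *)
  have i3 : im (e 1%N).
    have := wE p.-1%N ltac:(lia).
    do 3?[rewrite ifF; last lia].
    rewrite !big_cons big_nil addr0 addrA => /imB /(_ i0').
    rewrite (addrAC (e 0%N + _)) subrr add0r => /imB /(_ i0).
    by rewrite (addrAC (e 0%N)) subrr add0r.
  have i2 : im (e 2%N).
    have := wE 0%N ltac:(lia).
    rewrite !big_cons big_nil addr0 => /imB /(_ i3).
    by rewrite addrA addrK => /imB /(_ i0); rewrite addrK.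
  case: x => [|[|[|x]]] xp //; apply: i1; lia.
Qed.

End ZetaPrime.

(** * The eigenvector and the dominant root *)

Section SpecialPisotUnit.
Variables (R : realType) (alpha beta : R) (p : nat).

Definition letter_weight k := if (k %% p == 0)%N then alpha else beta ^+ (k %% p).

Hypotheses (hp : (3 <= p)%N) (a1 : 1 < alpha) (b1 : 1 < beta).
Hypotheses (abD : alpha * beta = alpha + beta) (ab : alpha ^+ 2 = beta ^+ p).

Let lam := if odd p then beta else beta ^+ 2.

Lemma letter_weight_gt0 k : 0 < letter_weight k.
Proof.
have a0 : 0 < alpha by apply: lt_trans a1.
have b0 : 0 < beta by apply: lt_trans b1.
by rewrite /letter_weight; case: ifP => // _; rewrite exprn_gt0.
Qed.

(** After multiplication by beta, [abD] reduces the right side to alpha^2. Together with [ab] this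
    lets the later identities be checked by [ring]. *)
Lemma beta_expp1 : beta ^+ p.-1 = alpha ^+ 2 - alpha.
Proof.
have b0 : beta != 0 by rewrite gt_eqF // (lt_trans _ b1).
apply: (mulfI b0); rewrite -exprS prednK -?ab; last lia.
have -> : beta * (alpha ^+ 2 - alpha) = alpha * (alpha * beta) - alpha * beta by ring.
by rewrite abD; ring: abD.
Qed.

Lemma letter_weight0 : letter_weight 0 = alpha.
Proof. by rewrite /letter_weight mod0n. Qed.

Lemma letter_weightp : letter_weight p = alpha.
Proof. by rewrite /letter_weight modnn. Qed.

Lemma letter_weight_small k : (0 < k < p)%N -> letter_weight k = beta ^+ k.
Proof.
move=> /andP [k0 kp].
by rewrite /letter_weight modn_small // ifN // -lt0n.
Qed.

Lemma letter_weight_addl k : letter_weight (p + k) = letter_weight k.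
Proof. by rewrite /letter_weight modnDl. Qed.

(** One-letter images only shift the exponent of beta. The other letters use alpha beta = alpha +
    beta and alpha^2 = alpha + beta^(p-1). *)
Lemma sum_letter_weight k : (k <= top_letter p)%N ->
  \sum_(x <- zeta_word p k) letter_weight x = lam * letter_weight k.
Proof.
have bp1 := beta_expp1.
have bp : beta * beta ^+ p.-1 = alpha ^+ 2 by rewrite -exprS prednK -?ab //; lia.
have wS j : (0 < j < p.-1)%N -> beta * letter_weight j = letter_weight j.+1.
  by move=> hj; rewrite !letter_weight_small ?exprS //; lia.
have wp1 : letter_weight p.-1 = beta ^+ p.-1 by rewrite letter_weight_small //; lia.
have w1 : letter_weight 1 = beta by rewrite letter_weight_small ?expr1 //; lia.
have w2 : letter_weight 2 = beta ^+ 2 by rewrite letter_weight_small //; lia.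
have w0 := letter_weight0.
rewrite /lam /zeta_word /top_letter; case: (boolP (odd p)) => o kt.
- case: (eqVneq k 0%N) => [->|k0].
    rewrite !big_cons big_nil addr0 letter_weight_addl letter_weightp w0 w1.
    by rewrite mulrC abD addrC.
  case: ifPn => [kp|]; last move=> kp.
    by rewrite big_seq1 -addnA addn1 letter_weight_addl wS //; lia.
  case: (eqVneq k (p - 1)%N) => [->|k1].
    have -> : (2 * p - 1 = p + p.-1)%N by lia.
    rewrite !big_cons big_nil addr0 letter_weight_addl subn1 w0 wp1 bp bp1; ring.
  case: (eqVneq k p) => [->|k2].
    by rewrite !big_cons big_nil addr0 letter_weightp w0 w1 mulrC abD.
  case: ifPn => [k3|]; last move=> k3.
    have -> : k = (p + (k - p))%N by lia.
    rewrite big_seq1 letter_weight_addl addKn addn1 wS //; lia.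
  have -> : k = (p + p.-1)%N by lia.
  rewrite !big_cons big_nil addr0 letter_weight_addl subn1 letter_weightp wp1.
  rewrite bp bp1; ring.
- have p4 : (4 <= p)%N by lia.
  case: (eqVneq k 0%N) => [->|k0].
    rewrite !big_cons big_nil addr0 w0 w1 w2.
    rewrite !expr2 -mulrA [beta * alpha]mulrC abD mulrDr [beta * alpha]mulrC abD.
    by ring.
  case: ifPn => [kp|]; last move=> kp.
    rewrite big_seq1 addn2 -wS; last lia.
    by rewrite -wS ?mulrA //; lia.
  case: (eqVneq k (p - 2)%N) => [->|k1].
    rewrite !big_cons big_nil addr0 subn1 w0 wp1 letter_weight_small; last lia.
    have -> : beta ^+ 2 * beta ^+ (p - 2) = beta ^+ p.
      by rewrite -exprD (subnKC (ltnW hp)).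
    by rewrite -ab bp1; ring.
  have -> : k = p.-1 by lia.
  rewrite !big_cons big_nil addr0 subn1 w0 w1 wp1 expr2 -mulrA bp bp1.
  have -> : beta * alpha ^+ 2 = alpha * (alpha * beta) by ring.
  by rewrite abD mulrDr abD; ring.
Qed.

Lemma dominant_root_zeta' : dominant_root (@zeta' p) lam.
Proof.
apply: (@positive_dominant_root _ _ _ _ (letter_weight : 'I__ -> R)).
- exact: zeta'_primitive.
- by rewrite /lam; case: ifP => _; rewrite ?exprn_gt0 // (lt_trans _ b1).
- by move=> j; apply: letter_weight_gt0.
- by move=> j; rewrite sum_zeta' // sum_letter_weight // leq_ord.
Qed.

(** Both alpha and beta^(p/2) are positive with the same square; dividing alpha beta = alpha + beta
    by beta then gives the second equation. *)
Lemma beta_exp_half : ~~ odd p -> alpha = beta ^+ p./2 /\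
  beta ^+ p./2 = beta ^+ p./2.-1 + 1.
Proof.
move=> o; have b0 : 0 < beta by apply: lt_trans b1.
have aE : alpha = beta ^+ p./2.
  apply/eqP; rewrite -(@eqrXn2 _ 2) // ?exprn_ge0 ?ltW //; last exact: lt_trans a1.
  by rewrite -exprM muln2 even_halfK // ab.
split=> //; apply: (mulfI (lt0r_neq0 b0)).
rewrite mulrDr mulr1 -[beta * _ ^+ _.-1]exprS prednK; last by rewrite half_gt0; lia.
by rewrite -aE -abD mulrC.
Qed.

Hypotheses (aint : algebraic_integer alpha) (bpisot : pisot_number beta).

Lemma algebraic_integerX (x : R) n : algebraic_integer x -> algebraic_integer (x ^+ n).
Proof.
move=> xi; elim: n => [|n IH]; first by rewrite expr0; apply: integral1.
by rewrite exprS; apply: integral_mul.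
Qed.

Lemma lam_algebraic_integer : algebraic_integer lam.
Proof.
by have [bi _ _] := bpisot; rewrite /lam; case: ifP => // _; apply: algebraic_integerX.
Qed.

Lemma in_field_alpha_beta : in_field alpha beta.
Proof.
have -> : beta = alpha * (alpha - 1)^-1.
  apply: (mulIf (x := alpha - 1)); first by rewrite subr_eq0 gt_eqF.
  by rewrite mulfVK ?subr_eq0 ?gt_eqF // mulrBr mulr1 mulrC abD addrK.
apply: in_fieldM (in_field_id _) _; apply: in_fieldV => //.
by apply: in_fieldB (in_field_id _) (in_field1 _).
Qed.

(** For even p, beta is the quotient of beta^(p/2) by beta^(p/2-1). The one with even exponent lies
    in Q(beta^2), and the other differs from it by 1. *)
Lemma in_field_lam_beta : in_field lam beta.
Proof.
have lint := lam_algebraic_integer; move: lint; rewrite /lam.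
case: (boolP (odd p)) => o lint; first exact: in_field_id.
have [_ bq] := beta_exp_half o.
have b0 : beta != 0 by rewrite gt_eqF // (lt_trans _ b1).
rewrite [X in in_field _ X](_ : beta = beta ^+ p./2 * (beta ^+ p./2.-1)^-1); last first.
  rewrite -{1}(@prednK p./2); last by rewrite half_gt0; lia.
  by rewrite exprS mulfK // expf_neq0.
have ev n : ~~ odd n -> in_field (beta ^+ 2) (beta ^+ n).
  move=> on; rewrite -(even_halfK on) -mul2n exprM.
  by apply: in_fieldX; apply: in_field_id.
case: (boolP (odd p./2)) => oq.
  have bq1 : in_field (beta ^+ 2) (beta ^+ p./2.-1) by apply: ev; lia.
  apply: in_fieldM; last exact: in_fieldV.
  by rewrite bq; apply: in_fieldD bq1 (in_field1 _).
have bq1 := ev _ oq; apply: in_fieldM => //; apply: in_fieldV => //.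
have -> : beta ^+ p./2.-1 = beta ^+ p./2 - 1 by rewrite bq addrK.
exact: in_fieldB bq1 (in_field1 _).
Qed.

Lemma in_field_lam_alpha : in_field lam alpha.
Proof.
have lb := in_field_lam_beta; have li := lam_algebraic_integer.
have -> : alpha = beta * (beta - 1)^-1.
  apply: (mulIf (x := beta - 1)); first by rewrite subr_eq0 gt_eqF.
  by rewrite mulfVK ?subr_eq0 ?gt_eqF // mulrBr mulr1 abD addrC addKr.
apply: in_fieldM => //; apply: in_fieldV => //.
exact: in_fieldB lb (in_field1 _).
Qed.

Lemma in_field_alpha_lam : in_field alpha lam.
Proof.
by rewrite /lam; case: ifP => _; [|apply: in_fieldX]; apply: in_field_alpha_beta.
Qed.

(** If beta = g(beta^2), a conjugate z of beta^2 is the square of g(z), a conjugate of beta. It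
    differs from beta unless z = beta^2, so |z| = |g(z)|^2 < 1. *)
Lemma pisot_lam : pisot_number lam.
Proof.
have [bi _ bconj] := bpisot; have lb := in_field_lam_beta.
have li := lam_algebraic_integer; move: lb li; rewrite /lam.
case: (boolP (odd p)) => // o [g gE] li; split=> //.
  exact: exprn_egt1.
move=> z /galois_conjugate_specializes lz zl.
have bs : specializes beta (evalq g z) by rewrite -gE; apply: specializes_evalq.
have zE : (evalq g z) ^+ 2 = z.
  have := @specializes_eq _ _ _ _ (g ^+ 2) 'X lz.
  rewrite !expr2 !evalqM !evalqX; apply.
  by rewrite /evalq gE.
rewrite -zE normrX exprn_ilt1 //.
apply: bconj; first exact: specializes_galois_conjugate.
by apply: contraNneq zl => e; rewrite -zE e rmorphXn.
Qed.

End SpecialPisotUnit.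

(** * Uniqueness of graph-directed attractors *)

Section KspaceTopology.
Variable R : realType.

Lemma cabs_continuous : continuous (@cabs R : R[i]^o -> R).
Proof.
move=> z A /nbhs_ballP [e e0 zA]; apply/nbhs_ballP.
exists e%:C%C; first by rewrite /= ltcR.
move=> w; rewrite /ball /= => zw; apply: zA; rewrite /ball /=.
rewrite -ltcR; apply: le_lt_trans zw.
have := @ler_dist_dist _ _ z w.
rewrite -!cabsE -rmorphB /= -[X in X <= _]cabsE.
by rewrite cabs_real.
Qed.

Lemma geometric_small (q M : R) : 0 <= q -> q < 1 -> forall e, 0 < e ->
  \forall n \near \oo, q ^+ n * M < e.
Proof.
move=> q0 q1 e e0.
have qc : q ^+ n * M @[n --> \oo] --> 0 * M.
  by apply: cvgM; [apply: cvg_expr; rewrite ger0_norm | apply: cvg_cst].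
rewrite mul0r in qc; have /cvgr_lt := qc; apply.
exact: e0.
Qed.

(** Summing absolute values, rather than taking a maximum, also covers an empty index type, as when
    there are no real or no non-real conjugates. *)
Lemma finite_bound (I : finType) (P : I -> R -> Prop) :
  (forall i, exists M, forall N, M <= N -> P i N) ->
  exists M, forall N, M <= N -> forall i, P i N.
Proof.
move=> /choice [M MP]; exists (\sum_i `|M i|) => N MN i; apply: MP.
apply: le_trans (ler_norm _) _; apply: le_trans MN.
by rewrite (bigD1 i) //= lerDl sumr_ge0.
Qed.

Variables r s : nat.
Implicit Types (x y u c : Kspace R r s) (A B : set (Kspace R r s)).

Lemma Kspace_cvg (T : Type) (F : set_system T) {FF : Filter F}
    (f : T -> Kspace R r s) x :
  (forall k, (f t).1 0 k @[t --> F] --> x.1 0 k) ->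
  (forall k, ((f t).2 0 k : R[i]^o) @[t --> F] --> (x.2 0 k : R[i]^o)) ->
  f @ F --> x.
Proof.
move=> f1 f2 A [[B1 B2] /= [[P1 P1x P1B] [P2 P2x P2B]] BA].
have h1 : \forall t \near F, forall k, P1 0 k ((f t).1 0 k).
  by apply: filter_forall => k; apply: f1; apply: P1x.
have h2 : \forall t \near F, forall k, P2 0 k ((f t).2 0 k).
  by apply: filter_forall => k; apply: f2; apply: P2x.
near=> t; apply: BA; split=> /=.
  by apply: P1B => i j; rewrite ord1; move: j; near: t.
by apply: P2B => i j; rewrite ord1; move: j; near: t.
Unshelve. all: by end_near. Qed.

Lemma coord1_continuous k : continuous (fun x : Kspace R r s => x.1 0 k).
Proof.
move=> x; apply: (@continuous_comp _ _ _ fst (fun y : 'rV[R]_r => y 0 k)).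
  exact: cvg_fst.
exact: coord_continuous.
Qed.

Lemma coord2_continuous k :
  continuous (fun x : Kspace R r s => x.2 0 k : R[i]^o).
Proof.
move=> x; apply: (@continuous_comp _ _ _ snd (fun y : 'rV[R[i]^o]_s => y 0 k)).
  exact: cvg_snd.
exact: coord_continuous.
Qed.

Lemma Kspace_hausdorff : hausdorff_space (Kspace R r s).
Proof.
move=> x y cxy; rewrite [x]surjective_pairing [y]surjective_pairing.
congr (_, _); apply/rowP => k.
  apply: (@norm_hausdorff _ R^o) => A B xA yB.
  have [z [zA zB]] := cxy _ _ (coord1_continuous xA) (coord1_continuous yB).
  by exists (z.1 0 k).
apply: (@norm_hausdorff _ R[i]^o) => A B xA yB.
have [z [zA zB]] := cxy _ _ (coord2_continuous xA) (coord2_continuous yB).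
by exists (z.2 0 k).
Qed.

Lemma compact_coord_bounded A : compact A ->
  exists M, forall N, M <= N -> forall x, A x ->
    (forall k, `|x.1 0 k| <= N) /\ forall k, cabs (x.2 0 k) <= N.
Proof.
move=> cA.
have bdd (f : Kspace R r s -> R) : continuous f ->
    exists M, forall N, M <= N -> forall x, A x -> `|f x| <= N.
  move=> fc; have : bounded_set (f @` A).
    apply: (@compact_bounded R R^o); apply: continuous_compact => //.
    by apply: continuous_subspaceT.
  move=> /pinfty_ex_gt0 [M _ fM]; exists M => N MN x Ax.
  by apply: le_trans MN; apply: fM; exists x.
have [M1 h1] := finite_bound (fun k => bdd _ (@coord1_continuous k)).
have c2 k : continuous (fun x : Kspace R r s => cabs (x.2 0 k)).
  move=> x; apply: continuous_comp; first exact: coord2_continuous.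
  exact: cabs_continuous.
have [M2 h2] := finite_bound (fun k => bdd _ (c2 k)).
exists (Num.max M1 M2) => N; rewrite ge_max => /andP [N1 N2] x Ax.
by split=> k; [apply: h1 | apply: le_trans (ler_norm _) _; apply: h2].
Qed.

(** All edges share the linear part [Kmul u]; [E a b c] says that [c] is the translation part of an
    edge mapping the set at [b] into the set at [a]. *)
Definition graph_ifs (I : Type) (u : Kspace R r s)
    (E : I -> I -> Kspace R r s -> Prop) (T : I -> set (Kspace R r s)) :=
  forall a, T a = [set x | exists b c y, [/\ E a b c, T b y & x = c + Kmul u y]].

Section GraphIFS.
Variables (I : finType) (u : Kspace R r s).
Variables (E : I -> I -> Kspace R r s -> Prop).
Hypothesis u1 : forall k, `|u.1 0 k| < 1.
Hypothesis u2 : forall k, cabs (u.2 0 k) < 1.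

(** Unfold a point of [T a] along n edges and run the same edges from a point of some [X b]. The
    result lies in [X a], and the translations cancel in the difference, which is u^n times a
    bounded vector. As [X a] is closed, it contains the limit. *)
Lemma graph_ifs_sub (T X : I -> set (Kspace R r s)) :
  graph_ifs u E T -> graph_ifs u E X ->
  (forall a, compact (T a)) -> (forall a, compact (X a)) ->
  (forall a, X a !=set0) -> forall a, T a `<=` X a.
Proof.
move=> TE XE Tc Xc X0.
have approx n : forall a x, T a x -> exists x', X a x' /\
    exists b t y, [/\ T b t, X b y,
      forall k, x.1 0 k - x'.1 0 k = u.1 0 k ^+ n * (t.1 0 k - y.1 0 k) &
      forall k, x.2 0 k - x'.2 0 k = u.2 0 k ^+ n * (t.2 0 k - y.2 0 k)].
  elim: n => [|n IH] a x Tx.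
    have [x' Xx'] := X0 a; exists x'; split=> //; exists a, x, x'.
    by split=> // k; rewrite expr0 mul1r.
  move: Tx; rewrite TE => -[b [c [x1 [Eab Tx1 ->]]]].
  have [x1' [Xx1' [d [t [y [Tt Xy e1 e2]]]]]] := IH _ _ Tx1.
  exists (c + Kmul u x1'); split; first by rewrite XE; exists b, c, x1'.
  exists d, t, y; split=> // k.
    by rewrite exprS -mulrA -e1 !mxE; ring.
  by rewrite exprS -mulrA -e2 !mxE; ring.
move=> a x Tx.
have [f fP] := choice (fun n => approx n a x Tx).
have [MT bT] := finite_bound (fun b => compact_coord_bounded (Tc b)).
have [MX bX] := finite_bound (fun b => compact_coord_bounded (Xc b)).
have [M MP] : exists M, forall b y, T b y \/ X b y ->
    (forall k, `|y.1 0 k| <= M) /\ forall k, cabs (y.2 0 k) <= M.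
  exists (Num.max MT MX) => b y [] h.
    by apply: (bT _ _ b) => //; rewrite le_max lexx.
  by apply: (bX _ _ b) => //; rewrite le_max lexx orbT.
suff fx : f @ \oo --> x.
  have Xcl := compact_closed Kspace_hausdorff (Xc a).
  apply: (@closed_cvg _ _ \oo _ f (X a) Xcl _ x fx).
  by near=> n; have [] := fP n.
apply: Kspace_cvg => k A /nbhs_ballP [e e0 xA].
  have := @geometric_small _ (M + M) (normr_ge0 (u.1 0 k)) (u1 k) _ e0.
  apply: filterS => n small; apply: xA.
  have [_ [b [t [y [Tt Xy e1 _]]]]] := fP n.
  rewrite /ball /= e1 normrM normrX; apply: le_lt_trans small.
  rewrite ler_wpM2l ?exprn_ge0 // (le_trans (ler_normB _ _)) // lerD //.
    by have [] := MP b t (or_introl Tt).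
  by have [] := MP b y (or_intror Xy).
(* The radius of a ball of [R[i]] is an element of [R[i]]; being positive it is real, so the
   estimate can be made in [R]. *)
have eE : e = (complex.Re e)%:C%C by rewrite RRe_real // gtr0_real.
have e'0 : 0 < complex.Re e by rewrite -ltcR -eE.
have cu0 : 0 <= cabs (u.2 0 k) by rewrite -ler0c cabsE.
have := @geometric_small _ (M + M) cu0 (u2 k) _ e'0.
apply: filterS => n small; apply: xA.
have [_ [b [t [y [Tt Xy _ e2]]]]] := fP n.
rewrite /ball /= e2 normrM normrX eE -!cabsE -rmorphXn -rmorphM ltcR.
apply: le_lt_trans small.
rewrite ler_wpM2l ?exprn_ge0 // -lecR cabsE (le_trans (ler_normB _ _)) //.
rewrite -!cabsE -rmorphD lecR lerD //.
  by have [] := MP b t (or_introl Tt).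
by have [] := MP b y (or_intror Xy).
Unshelve. all: by end_near. Qed.

Lemma graph_ifs_unique (T X : I -> set (Kspace R r s)) :
  graph_ifs u E T -> graph_ifs u E X ->
  (forall a, T a !=set0 /\ compact (T a)) ->
  (forall a, X a !=set0 /\ compact (X a)) -> forall a, T a = X a.
Proof.
move=> TE XE TP XP a.
have [Tc Xc] := (fun b => (TP b).2, fun b => (XP b).2).
by apply/seteqP; split; apply: graph_ifs_sub => // b; [case: (XP b) | case: (TP b)].
Qed.

End GraphIFS.
End KspaceTopology.

(** * The graph-directed system of the tiles X_k *)

Lemma cat_cons_split (T : Type) (x a : T) w U V : x :: w = U ++ a :: V ->
  (U = [::] /\ a = x) \/ exists2 U', U = x :: U' & w = U' ++ a :: V.
Proof. by case: U => [|u U] [-> e]; [left|right; exists U]. Qed.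

Lemma cat_cons_nil (T : Type) (a : T) U V : [::] <> U ++ a :: V.
Proof. by case: U. Qed.

Section Pieces.
Variables (R : realType) (r s : nat) (alpha : R).
Variables (cr : r.-tuple R) (cc : s.-tuple R[i]).
Hypothesis sr : forall k, specializes alpha (tnth cr k).
Hypothesis sc : forall k, specializes alpha (tnth cc k).

Local Notation psi := (psi alpha cr cc).

Lemma Kspace_eq (x y : Kspace R r s) :
  (forall k, x.1 0 k = y.1 0 k) -> (forall k, x.2 0 k = y.2 0 k) -> x = y.
Proof.
move=> h1 h2; rewrite [x]surjective_pairing [y]surjective_pairing.
by congr (_, _); apply/rowP.
Qed.

Lemma psiD u v : in_field alpha u -> in_field alpha v ->
  psi (u + v) = psi u + psi v.
Proof.
by move=> fu fv; apply: Kspace_eq => k; rewrite !mxE field_imageD.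
Qed.

Lemma psiN u : in_field alpha u -> psi (- u) = - psi u.
Proof. by move=> fu; apply: Kspace_eq => k; rewrite !mxE field_imageN. Qed.

Lemma psiM u v : in_field alpha u -> in_field alpha v ->
  psi (u * v) = Kmul (psi u) (psi v).
Proof.
by move=> fu fv; apply: Kspace_eq => k; rewrite !mxE field_imageM.
Qed.

Lemma psi0 : psi 0 = 0.
Proof.
apply: Kspace_eq => k; rewrite !mxE -[X in field_image _ _ X](rmorph0 (@ratr R));
  by rewrite field_image_rat // rmorph0.
Qed.

Lemma KmulA (u v x : Kspace R r s) : Kmul u (Kmul v x) = Kmul (Kmul u v) x.
Proof. by apply: Kspace_eq => k; rewrite !mxE mulrA. Qed.

Lemma KmulDr (u x y : Kspace R r s) : Kmul u (x + y) = Kmul u x + Kmul u y.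
Proof. by apply: Kspace_eq => k; rewrite !mxE mulrDr. Qed.

Lemma KmulrN (u x : Kspace R r s) : Kmul u (- x) = - Kmul u x.
Proof. by apply: Kspace_eq => k; rewrite !mxE mulrN. Qed.

Lemma KmulNr (u x : Kspace R r s) : Kmul (- u) x = - Kmul u x.
Proof. by apply: Kspace_eq => k; rewrite !mxE mulNr. Qed.

Lemma Kmul_psi1 x : Kmul x (psi 1) = x.
Proof.
apply: Kspace_eq => k; rewrite !mxE -[X in field_image _ _ X](rmorph1 (@ratr R));
  by rewrite field_image_rat // rmorph1 mulr1.
Qed.

Variable F : set (Kspace R r s).

(** The set S(c, d). *)
Definition piece (c d : R) : set (Kspace R r s) :=
  [set psi c + Kmul (psi d) y | y in F].

Lemma piece_Psi d : [set Psi alpha cr cc d x | x in F] = piece 0 d.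
Proof. by apply/eq_imagel => x _; rewrite psi0 add0r. Qed.

Lemma piece_set_sub c d : in_field alpha d ->
  set_sub (psi c) [set Psi alpha cr cc d x | x in F] = piece c (- d).
Proof.
move=> fd; rewrite /set_sub image_comp; apply/eq_imagel => x _ /=.
by rewrite psiN // KmulNr.
Qed.

(** Affine maps with coefficients in Q(alpha) act on the parameters (c, d), which turns set
    equations into identities between numbers. *)
Lemma piece_affine u v c d x : in_field alpha u -> in_field alpha v ->
  in_field alpha c -> in_field alpha d ->
  piece (u + v * c) (v * d) x <->
  exists2 y, piece c d y & x = psi u + Kmul (psi v) y.
Proof.
move=> fu fv fc fd.
have e y : psi (u + v * c) + Kmul (psi (v * d)) y =
    psi u + Kmul (psi v) (psi c + Kmul (psi d) y).
  by rewrite psiD ?psiM //; [rewrite KmulDr KmulA addrA | apply: in_fieldM].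
split=> [[y Fy <-]|[_ [y Fy <-] ->]]; last by exists y.
by exists (psi c + Kmul (psi d) y); [exists y | rewrite e].
Qed.

Variable beta : R.
Hypotheses (hF : is_tent_tile alpha cr cc F) (bE : beta = alpha / (alpha - 1)).
Hypothesis fb : in_field alpha beta.

(* Every [X_k] is a [piece]; subdividing it at most twice by this rule yields
   exactly the right-hand side of its Rauzy equation. *)
Lemma piece_split c d : in_field alpha c -> in_field alpha d ->
  piece c d = piece c (d * alpha) `|` piece (c + d * beta) (- (d * beta)).
Proof.
move=> fc fd; have [_ _ FE] := hF; have fa := in_field_id alpha.
have fdb := in_fieldM fd fb.
have e1 y : psi c + Kmul (psi (d * alpha)) y =
    psi c + Kmul (psi d) (Psi alpha cr cc alpha y).
  by rewrite /Psi psiM // KmulA.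
have e2 y : psi (c + d * beta) + Kmul (psi (- (d * beta))) y =
    psi c + Kmul (psi d) (Psi alpha cr cc beta (psi 1 - y)).
  rewrite /Psi KmulDr KmulrN Kmul_psi1 psiD // psiN // psiM //.
  by rewrite KmulDr KmulNr KmulrN KmulA addrA.
apply/seteqP; split=> x.
  move=> [y]; rewrite {1}FE -bE => -[] [z Fz <-] <-; [left|right]; exists z => //.
move=> [] [y Fy <-].
  by rewrite e1; exists (Psi alpha cr cc alpha y) => //; rewrite FE; left; exists y.
rewrite e2; exists (Psi alpha cr cc beta (psi 1 - y)) => //.
by rewrite FE -bE; right; exists y.
Qed.

(** Parameters (c, d) of X_k as a set S(c, d); the scale d is negative exactly for the tiles of the
    form constant minus set. *)
Definition tile_coef (p k : nat) : R * R :=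
  if (p == 3)%N then
    nth (0, 0) [:: (0, alpha); (beta, - (alpha * beta)); (0, beta ^+ 2);
      (alpha, - alpha); (0, alpha * beta); (beta ^+ 2, - beta ^+ 2)] k
  else if (k == p.-1)%N then (beta ^+ k, - beta ^+ k)
  else if odd k then (beta ^+ k, - (alpha * beta ^+ k))
  else (0, alpha * beta ^+ k).

Lemma in_field_tile_coef p k :
  in_field alpha (tile_coef p k).1 /\ in_field alpha (tile_coef p k).2.
Proof.
have fa := in_field_id alpha; have f0 := in_field0 alpha.
have fX n := in_fieldX n fb; have fM n := in_fieldM fa (fX n).
have fab := in_fieldM fa fb.
rewrite /tile_coef; case: ifP => _.
  by move: k => [|[|[|[|[|[|[|k]]]]]]]; split=> //=; apply: in_fieldN.
by case: ifP => _; [|case: ifP => _]; split=> //=; apply: in_fieldN.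
Qed.

Lemma Xtile_piece p k : (k <= top_letter p)%N ->
  Xtile alpha beta cr cc F p k = piece (tile_coef p k).1 (tile_coef p k).2.
Proof.
have fa := in_field_id alpha; have fX n := in_fieldX n fb.
have fM n := in_fieldM fa (fX n); have fab := in_fieldM fa fb.
rewrite /Xtile /tile_coef /X_even; case: (eqVneq p 3%N) => [->|_] kp.
  move: k kp => [|[|[|[|[|[|]]]]]] //= _;
    rewrite ?piece_set_sub ?piece_Psi //.
case: (eqVneq k p.-1) => [->|_]; first by rewrite piece_set_sub.
by case: ifP => _; rewrite ?piece_set_sub ?piece_Psi.
Qed.

Variable p : nat.
Hypotheses (hp : (p == 3) || (~~ odd p) && (4 <= p)%N).
Hypotheses (b0 : beta != 0) (abD : alpha * beta = alpha + beta).
Hypotheses (ab : alpha ^+ 2 = beta ^+ p) (bp1 : beta ^+ p.-1 = alpha ^+ 2 - alpha).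

Let lam := if odd p then beta else beta ^+ 2.
Let offset (U : seq nat) := \sum_(x <- U) letter_weight alpha beta p x.
Let c_ k := (tile_coef p k).1.
Let d_ k := (tile_coef p k).2.

(* Image of [X_b] under the map attached to the prefix [U], for the eigenvector
   of entries [- letter_weight alpha beta p k]; passing to a positive
   eigenvector costs a negative scalar of [rat(lam)]. *)
Definition edge_piece b U := piece (- offset U + lam * c_ b) (lam * d_ b).

Let fcoef k : in_field alpha (c_ k) /\ in_field alpha (d_ k) := in_field_tile_coef p k.

Let left_sub c d x : in_field alpha c -> in_field alpha d ->
  piece c (d * alpha) x -> piece c d x.
Proof. by move=> fc fd h; rewrite piece_split //; left. Qed.

Let right_sub c d x : in_field alpha c -> in_field alpha d ->
  piece (c + d * beta) (- (d * beta)) x -> piece c d x.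
Proof. by move=> fc fd h; rewrite piece_split //; right. Qed.

(** A tile is cut into as many parts as its letter has occurrences in the images: letters 1 and 4
    occur once and their tiles stay whole, the others occur twice and their tiles are split once. *)
Lemma tile_three_system : p = 3 -> forall a x, (a <= 5)%N ->
  piece (c_ a) (d_ a) x <->
  exists b U V, [/\ (b <= 5)%N, zeta_word p b = U ++ a :: V & edge_piece b U x].
Proof.
move=> p3.
have lE : lam = beta by rewrite /lam p3.
have b3 : beta ^+ 3 = alpha ^+ 2 by rewrite ab p3.
have b2 : beta ^+ 2 = alpha ^+ 2 - alpha by rewrite -bp1 p3.
have w x : (x <= 5)%N -> letter_weight alpha beta p x =
    nth 0 [:: alpha; beta; beta ^+ 2; alpha; beta; beta ^+ 2] x.
  by rewrite p3; move: x => [|[|[|[|[|[|]]]]]] //= _; rewrite /letter_weight /= ?expr1.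
have coefE c d c' d' : c = c' -> d = d' -> piece c d = piece c' d' by move=> -> ->.
have split a := @piece_split _ _ (fcoef a).1 (fcoef a).2.
(* In [Ebj] the digit [b] is the source letter and [j] the length of the prefix. The right side is a
   part of the tile of the letter that follows this prefix. *)
have E00 : edge_piece 0 [::] = piece (c_ 4) (d_ 4).
  rewrite /edge_piece /offset big_nil lE /c_ /d_ /tile_coef p3 /=; apply: coefE; ring.
have E01 : edge_piece 0 [:: 4] = piece (c_ 3 + d_ 3 * beta) (- (d_ 3 * beta)).
  rewrite /edge_piece /offset !big_cons big_nil lE !w // /c_ /d_ /tile_coef p3 /=.
  by apply: coefE; ring: abD.
have E10 : edge_piece 1 [::] = piece (c_ 5) (d_ 5 * alpha).
  rewrite /edge_piece /offset big_nil lE /c_ /d_ /tile_coef p3 /=; apply: coefE; ring.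
have E20 : edge_piece 2 [::] = piece (c_ 0) (d_ 0 * alpha).
  rewrite /edge_piece /offset big_nil lE /c_ /d_ /tile_coef p3 /=.
  by apply: coefE; ring: b3.
have E21 : edge_piece 2 [:: 0] = piece (c_ 5 + d_ 5 * beta) (- (d_ 5 * beta)).
  rewrite /edge_piece /offset !big_cons big_nil lE !w // /c_ /d_ /tile_coef p3 /=.
  by apply: coefE; ring: b3 b2.
have E30 : edge_piece 3 [::] = piece (c_ 0 + d_ 0 * beta) (- (d_ 0 * beta)).
  rewrite /edge_piece /offset big_nil lE /c_ /d_ /tile_coef p3 /=; apply: coefE; ring.
have E31 : edge_piece 3 [:: 0] = piece (c_ 1) (d_ 1).
  rewrite /edge_piece /offset !big_cons big_nil lE !w // /c_ /d_ /tile_coef p3 /=.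
  by apply: coefE; ring: abD.
have E40 : edge_piece 4 [::] = piece (c_ 2) (d_ 2 * alpha).
  rewrite /edge_piece /offset big_nil lE /c_ /d_ /tile_coef p3 /=; apply: coefE; ring.
have E50 : edge_piece 5 [::] = piece (c_ 2 + d_ 2 * beta) (- (d_ 2 * beta)).
  rewrite /edge_piece /offset big_nil lE /c_ /d_ /tile_coef p3 /=; apply: coefE; ring.
have E51 : edge_piece 5 [:: 2] = piece (c_ 3) (d_ 3 * alpha).
  rewrite /edge_piece /offset !big_cons big_nil lE !w // /c_ /d_ /tile_coef p3 /=.
  by apply: coefE; ring: b3 b2.
have zw : zeta_word p =1 zeta_word 3 by rewrite p3.
have sub1 a := @left_sub _ _ _ (fcoef a).1 (fcoef a).2.
have sub2 a := @right_sub _ _ _ (fcoef a).1 (fcoef a).2.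
move=> a x a5; split.
  move: a a5 => [|[|[|[|[|[|]]]]]] // _ h.
  - move: h; rewrite split => -[] h.
      by exists 2%N, [::], [:: 5]; rewrite E20 zw.
    by exists 3%N, [::], [:: 1]; rewrite E30 zw.
  - by exists 3%N, [:: 0], [::]; rewrite E31 zw.
  - move: h; rewrite split => -[] h.
      by exists 4%N, [::], [::]; rewrite E40 zw.
    by exists 5%N, [::], [:: 3]; rewrite E50 zw.
  - move: h; rewrite split => -[] h.
      by exists 5%N, [:: 2], [::]; rewrite E51 zw.
    by exists 0%N, [:: 4], [::]; rewrite E01 zw.
  - by exists 0%N, [::], [:: 3]; rewrite E00 zw.
  - move: h; rewrite split => -[] h.
      by exists 1%N, [::], [::]; rewrite E10 zw.
    by exists 2%N, [:: 0], [::]; rewrite E21 zw.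
move=> [b [U [V [b5 +]]]]; rewrite zw.
have one (y : nat) U' : [:: y] = U' ++ a :: V -> U' = [::] /\ a = y.
  by move=> e; case: (cat_cons_split e) => // -[U2 _ e1]; case: (cat_cons_nil e1).
move: b b5 => [|[|[|[|[|[|]]]]]] // _; rewrite /zeta_word /=.
- move=> e; case: (cat_cons_split e) => [[-> ->]|[U' -> e1]];
    [|case: (one _ _ e1) => -> ->]; rewrite ?E00 ?E01 //; exact: sub2.
- by move=> e; case: (one _ _ e) => -> ->; rewrite E10; apply: sub1.
- move=> e; case: (cat_cons_split e) => [[-> ->]|[U' -> e1]];
    [|case: (one _ _ e1) => -> ->]; rewrite ?E20 ?E21; [exact: sub1|exact: sub2].
- move=> e; case: (cat_cons_split e) => [[-> ->]|[U' -> e1]];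
    [|case: (one _ _ e1) => -> ->]; rewrite ?E30 ?E31 //; exact: sub2.
- by move=> e; case: (one _ _ e) => -> ->; rewrite E40; apply: sub1.
- move=> e; case: (cat_cons_split e) => [[-> ->]|[U' -> e1]];
    [|case: (one _ _ e1) => -> ->]; rewrite ?E50 ?E51; [exact: sub2|exact: sub1].
Qed.

(** Letter 0 occurs four times in the images, [p-1] three times, 1 twice, and every other letter
    once. Accordingly both halves of X_0 are split again, only the right half of X_(p-1) is, X_1 is
    split once, and the other tiles stay whole. *)
Lemma tile_even_system : ~~ odd p -> (4 <= p)%N -> forall a x, (a < p)%N ->
  piece (c_ a) (d_ a) x <->
  exists b U V, [/\ (b < p)%N, zeta_word p b = U ++ a :: V & edge_piece b U x].
Proof.
move=> o p4.
have lE : lam = beta ^+ 2 by rewrite /lam (negbTE o).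
have np3 : (p == 3)%N = false by lia.
have w0 := letter_weight0 alpha beta p.
have w1 : letter_weight alpha beta p 1 = beta.
  by rewrite letter_weight_small ?expr1 //; lia.
have w2 : letter_weight alpha beta p 2 = beta ^+ 2.
  by rewrite letter_weight_small //; lia.
have wp : letter_weight alpha beta p p.-1 = beta ^+ p.-1.
  by rewrite letter_weight_small //; lia.
have bp : beta * beta ^+ p.-1 = alpha ^+ 2 by rewrite -exprS prednK -?ab //; lia.
have bp2 : beta ^+ 2 * beta ^+ (p - 2) = alpha ^+ 2.
  by rewrite -exprD (subnKC (ltnW (ltnW p4))) ab.
have coefE c d c' d' : c = c' -> d = d' -> piece c d = piece c' d' by move=> -> ->.
have z0 : zeta_word p 0 = [:: 2; 0; 1]%N by rewrite /zeta_word (negbTE o).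
have zk k : (0 < k)%N -> (k + 2 < p)%N -> zeta_word p k = [:: k + 2]%N.
  by move=> k0 kp; rewrite /zeta_word (negbTE o) ifF ?ifT //; lia.
have zp2 : zeta_word p (p - 2) = [:: 0; p.-1]%N.
  by rewrite /zeta_word (negbTE o); do 2![rewrite ifF; last lia]; rewrite eqxx subn1.
have zp1 : zeta_word p p.-1 = [:: 0; p.-1; 0; 1]%N.
  by rewrite /zeta_word (negbTE o); do 3![rewrite ifF; last lia]; rewrite subn1.
have coef0 : (c_ 0 = 0) * (d_ 0 = alpha).
  by rewrite /c_ /d_ /tile_coef np3 ifF ?mulr1 //; lia.
have coef1 : (c_ 1 = beta) * (d_ 1 = - (alpha * beta)).
  by rewrite /c_ /d_ /tile_coef np3 ifF /= ?expr1 //; lia.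
have coefp : (c_ p.-1 = beta ^+ p.-1) * (d_ p.-1 = - beta ^+ p.-1).
  by rewrite /c_ /d_ /tile_coef np3 eqxx.
have coefp2 : (c_ (p - 2) = 0) * (d_ (p - 2) = alpha * beta ^+ (p - 2)).
  by rewrite /c_ /d_ /tile_coef np3 !ifF //; lia.
have coef2 k : (k + 2 < p.-1)%N ->
    (c_ (k + 2) = beta ^+ 2 * c_ k) * (d_ (k + 2) = beta ^+ 2 * d_ k).
  move=> kp; have e1 : (k + 2 == p.-1)%N = false by lia.
  have e2 : (k == p.-1)%N = false by lia.
  rewrite /c_ /d_ /tile_coef np3 e1 e2 oddD addbF.
  by case: ifP => _ /=; rewrite exprD; split; ring.
have Ek k : (k + 2 < p.-1)%N -> edge_piece k [::] = piece (c_ (k + 2)) (d_ (k + 2)).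
  move=> kp; rewrite /edge_piece /offset big_nil lE !coef2 //.
  by apply: coefE; ring.
have Ep3 : edge_piece (p - 3) [::] = piece (c_ p.-1) (d_ p.-1 * alpha).
  rewrite /edge_piece /offset big_nil lE !coefp /c_ /d_ /tile_coef np3.
  rewrite ifF ?ifT /=; [|lia..].
  have -> : p.-1 = (2 + (p - 3))%N by lia.
  by rewrite exprD; apply: coefE; ring.
have E01 : edge_piece 0 [:: 2] = piece (c_ 0 + d_ 0 * beta + - (d_ 0 * beta) * beta)
    (- (- (d_ 0 * beta) * beta)).
  rewrite /edge_piece /offset !big_cons big_nil lE w2 !coef0.
  by apply: coefE; ring: abD.
have E02 : edge_piece 0 [:: 2; 0] = piece (c_ 1 + d_ 1 * beta) (- (d_ 1 * beta)).
  rewrite /edge_piece /offset !big_cons big_nil lE w2 w0 !coef0 !coef1.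
  by apply: coefE; ring: abD.
have Ep20 : edge_piece (p - 2) [::] = piece (c_ 0) (d_ 0 * alpha * alpha).
  rewrite /edge_piece /offset big_nil lE !coef0 !coefp2.
  by apply: coefE; [ring | rewrite mulrCA bp2; ring].
have Ep21 : edge_piece (p - 2) [:: 0] =
    piece (c_ p.-1 + d_ p.-1 * beta) (- (d_ p.-1 * beta) * alpha).
  rewrite /edge_piece /offset !big_cons big_nil lE w0 !coefp !coefp2 bp1.
  by apply: coefE; [ring: abD | rewrite mulrCA bp2; ring: abD].
have Ep10 : edge_piece p.-1 [::] =
    piece (c_ 0 + d_ 0 * alpha * beta) (- (d_ 0 * alpha * beta)).
  rewrite /edge_piece /offset big_nil lE !coefp !coef0 bp1.
  by apply: coefE; ring: abD.
have Ep11 : edge_piece p.-1 [:: 0] =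
    piece (c_ p.-1 + d_ p.-1 * beta + - (d_ p.-1 * beta) * beta)
      (- (- (d_ p.-1 * beta) * beta)).
  rewrite /edge_piece /offset !big_cons big_nil lE w0 !coefp bp1.
  by apply: coefE; ring: abD.
have Ep12 : edge_piece p.-1 [:: 0; p.-1] =
    piece (c_ 0 + d_ 0 * beta) (- (d_ 0 * beta) * alpha).
  rewrite /edge_piece /offset !big_cons big_nil lE w0 wp !coefp !coef0 bp1.
  by apply: coefE; ring: abD.
have Ep13 : edge_piece p.-1 [:: 0; p.-1; 0] = piece (c_ 1) (d_ 1 * alpha).
  rewrite /edge_piece /offset !big_cons big_nil lE w0 wp !coefp !coef1 bp1.
  by apply: coefE; ring: abD.
have [fc fd] := (fun a => (fcoef a).1, fun a => (fcoef a).2).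
have fa := in_field_id alpha.
have fda a := in_fieldM (fd a) fa; have fdb a := in_fieldM (fd a) fb.
have fndb a := in_fieldN (fdb a); have fcd a := in_fieldD (fc a) (fdb a).
move=> a x ap; split.
  move=> h; case: (eqVneq a 0%N) h => [-> {ap}|a0] h.
    move: h; rewrite piece_split // => -[]; rewrite piece_split // => -[] h.
    - by exists (p - 2)%N, [::], [:: p.-1]; split; [lia|exact: zp2|rewrite Ep20].
    - by exists p.-1, [::], [:: p.-1; 0; 1]%N; split; [lia|exact: zp1|rewrite Ep10].
    - by exists p.-1, [:: 0; p.-1]%N, [:: 1]%N; split; [lia|exact: zp1|rewrite Ep12].
    - by exists 0%N, [:: 2]%N, [:: 1]%N; split; [lia|exact: z0|rewrite E01].
  case: (eqVneq a 1%N) h => [-> {ap}|a1] h.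
    move: h; rewrite piece_split // => -[] h.
    - by exists p.-1, [:: 0; p.-1; 0]%N, [::]; split; [lia|exact: zp1|rewrite Ep13].
    - by exists 0%N, [:: 2; 0]%N, [::]; split; [lia|exact: z0|rewrite E02].
  case: (eqVneq a p.-1) h => [-> {ap}|ap1] h.
    move: h; rewrite piece_split // => -[h|]; last rewrite piece_split // => -[] h.
    - exists (p - 3)%N, [::], [::]; split; [lia| |by rewrite Ep3].
      by rewrite zk /=; [congr [:: _]|..]; lia.
    - by exists (p - 2)%N, [:: 0]%N, [::]; split; [lia|exact: zp2|rewrite Ep21].
    - by exists p.-1, [:: 0]%N, [:: 0; 1]%N; split; [lia|exact: zp1|rewrite Ep11].
  have aE : a = (a - 2 + 2)%N by lia.
  case: (eqVneq a 2%N) h => [-> {ap}|a2] h.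
    exists 0%N, [::], [:: 0; 1]%N; split; [lia|exact: z0|rewrite Ek //; lia].
  exists (a - 2)%N, [::], [::]; split; [lia|rewrite zk -?aE //; lia|].
  by rewrite Ek -?aE //; lia.
move=> [b [U [V [bp']]]].
case: (eqVneq b 0%N) => [-> {bp'}|bn0].
  rewrite z0 => e; case: (cat_cons_split e) => [[-> ->]|[U1 -> {}e]].
    by rewrite Ek //; lia.
  case: (cat_cons_split e) => [[-> ->]|[U2 -> {}e]].
    by rewrite E01 => h; apply: right_sub => //; apply: right_sub.
  case: (cat_cons_split e) => [[-> ->]|[U3 _ {}e]];
    last by case: (cat_cons_nil e).
  by rewrite E02; apply: right_sub.
case: (ltnP (b + 2) p) => bk.
  rewrite zk //; last lia.
  move=> e; case: (cat_cons_split e) => [[-> ->]|[U1 _ {}e]];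
    last by case: (cat_cons_nil e).
  case: (ltnP (b + 2) p.-1) => bk1; first by rewrite Ek.
  have -> : b = (p - 3)%N by lia.
  have -> : (p - 3 + 2)%N = p.-1 by lia.
  by rewrite Ep3; apply: left_sub.
case: (eqVneq b (p - 2)%N) => [-> {bn0 bp' bk}|bn].
  rewrite zp2 => e; case: (cat_cons_split e) => [[-> ->]|[U1 -> {}e]].
    by rewrite Ep20 => h; apply: left_sub => //; apply: left_sub.
  case: (cat_cons_split e) => [[-> ->]|[U2 _ {}e]];
    last by case: (cat_cons_nil e).
  by rewrite Ep21 => h; apply: right_sub => //; apply: left_sub.
have -> : b = p.-1 by lia.
rewrite zp1 => e; case: (cat_cons_split e) => [[-> ->]|[U1 -> {}e]].
  by rewrite Ep10 => h; apply: left_sub => //; apply: right_sub.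
case: (cat_cons_split e) => [[-> ->]|[U2 -> {}e]].
  by rewrite Ep11 => h; apply: right_sub => //; apply: right_sub.
case: (cat_cons_split e) => [[-> ->]|[U3 -> {}e]].
  by rewrite Ep12 => h; apply: right_sub => //; apply: left_sub.
case: (cat_cons_split e) => [[-> ->]|[U4 _ {}e]];
    last by case: (cat_cons_nil e).
by rewrite Ep13; apply: left_sub.
Qed.

Lemma tile_system a x : (a <= top_letter p)%N ->
  piece (c_ a) (d_ a) x <->
  exists b U V, [/\ (b <= top_letter p)%N, zeta_word p b = U ++ a :: V
    & edge_piece b U x].
Proof.
case/orP: hp => [/eqP p3|/andP [op p4]].
  by rewrite (_ : top_letter p = 5%N) ?p3 // -p3; apply: tile_three_system.
have tE k : (k <= top_letter p)%N = (k < p)%N.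
  by rewrite /top_letter (negbTE op); lia.
rewrite tE => ap; rewrite tile_even_system //.
by split=> -[b [U [V [bp e h]]]]; exists b, U, V; rewrite ?tE in bp *.
Qed.

End Pieces.

(** * Matching the conjugates of two generators of a field *)

Section ConjugateListings.
Variable R : realType.

(** A listing keeps an arbitrary member of each non-real pair, so two listings match only up to such
    a conjugation. *)
Definition conj_if (e : bool) (z : R[i]) : R[i] := if e then conjc z else z.

Lemma conj_ifK e : involutive (conj_if e).
Proof. by case: e => z //=; apply: conjcK. Qed.

Lemma evalq_conj_if f e z : evalq f (conj_if e z) = conj_if e (evalq f z).
Proof. by case: e => //; apply: (evalq_rmorph (@conjc R)). Qed.

Lemma evalq_real_complex f (c : R) : evalq f c%:C%C = (evalq f c)%:C%C.
Proof. exact: (evalq_rmorph (real_complex R)). Qed.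

Lemma specializes_real (x c : R) : specializes x c%:C%C -> specializes x c.
Proof.
by move=> xc f /xc; rewrite evalq_real_complex => e; apply: (@complexI R).
Qed.

Section Listing.
Variables (x : R) (r s : nat) (cr : r.-tuple R) (cc : s.-tuple R[i]).
Hypothesis L : conjugate_listing x cr cc.

Lemma listing_specializes z :
  z \in [seq c%:C%C | c <- cr] ++ cc ++ [seq conjc c | c <- cc] ->
  specializes x z /\ z != x%:C%C.
Proof. by move=> /L.2 [/galois_conjugate_specializes]. Qed.

Lemma listing_real k : specializes x (tnth cr k) /\ tnth cr k != x.
Proof.
have [] := @listing_specializes (tnth cr k)%:C%C.
  by rewrite mem_cat map_f // mem_tnth.
by move=> /specializes_real ? nx; split=> //; apply: contraNneq nx => ->.
Qed.

Lemma listing_complex k : specializes x (tnth cc k) /\ tnth cc k != x%:C%C.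
Proof. by apply: listing_specializes; rewrite !mem_cat mem_tnth orbT. Qed.

Lemma listing_real_inj : injective (tnth cr).
Proof.
move=> i j e; have [+ _] := L; rewrite cat_uniq => /and3P [u _ _].
by move: e; have /map_uniq/tuple_uniqP := u; apply.
Qed.

(** The listed non-real conjugates and their complex conjugates are pairwise distinct. *)
Lemma listing_complex_inj i j e :
  conj_if e (tnth cc i) = tnth cc j -> e = false /\ i = j.
Proof.
have [+ _] := L; rewrite !cat_uniq => /and3P [_ _ /and3P [ucc dj _]].
case: e => /= e.
  case/negP: dj; apply/hasP; exists (tnth cc j); last exact: mem_tnth.
  by rewrite -e map_f // mem_tnth.
by split=> //; move/tuple_uniqP: ucc; apply.
Qed.

(** A real entry would be its own complex conjugate. *)
Lemma listing_nonreal j (c : R) : tnth cc j <> c%:C%C.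
Proof.
move=> e; have [] // := @listing_complex_inj j j true.
by rewrite /= e conjc_real.
Qed.

Lemma listing_cover z : algebraic_integer x -> specializes x z -> z != x%:C%C ->
  (exists k, z = (tnth cr k)%:C%C) \/ exists k e, tnth cc k = conj_if e z.
Proof.
move=> xi xz zx.
have : z \in [seq c%:C%C | c <- cr] ++ cc ++ [seq conjc c | c <- cc].
  by apply/L.2; split=> //; apply: specializes_galois_conjugate.
rewrite !mem_cat => /or3P
  [/mapP [c /tnthP [k ->] ->]|/tnthP [k ->]|/mapP [c /tnthP [k ->] ->]].
- by left; exists k.
- by right; exists k, false.
- by right; exists k, true; rewrite /= conjcK.
Qed.

End Listing.

(* An isomorphism [rat(x) = rat(y)] transports conjugates of [y] to conjugates
   of [x], up to complex conjugation for the non-real ones. *)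
Lemma listing_transport (x y : R) r s r' s' (cr : r.-tuple R) (cc : s.-tuple R[i])
    (cr' : r'.-tuple R) (cc' : s'.-tuple R[i]) :
  conjugate_listing x cr cc -> conjugate_listing y cr' cc' ->
  algebraic_integer x -> in_field y x -> in_field x y ->
  exists g (sg : 'I_r' -> 'I_r) (tau : 'I_s' -> 'I_s) (e : 'I_s' -> bool),
    [/\ x = evalq g y, injective sg, injective tau,
      forall k, tnth cr (sg k) = evalq g (tnth cr' k) &
      forall k, tnth cc (tau k) = conj_if (e k) (evalq g (tnth cc' k))].
Proof.
move=> L L' xi [g /esym gx] [h hy].
(* The identity h(g(y)) = y passes to every conjugate of y, so [g] is injective on conjugates, with
   inverse [h]. *)
have hg (K : numFieldType) (z : K) : specializes y z -> evalq h (evalq g z) = z.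
  move=> yz; rewrite -evalq_comp -[RHS]evalqX; apply: (specializes_eq yz).
  by rewrite evalq_comp evalqX /evalq -gx.
have xg (K : numFieldType) (z : K) : specializes y z -> specializes x (evalq g z).
  by move=> yz; rewrite gx; apply: specializes_evalq.
have hx : evalq h x = y := hy.
have real k : exists j, tnth cr j = evalq g (tnth cr' k).
  have [yk nk] := listing_real L' k.
  pose z := (evalq g (tnth cr' k))%:C%C.
  have [| |[j /complexI e]|[j [e je]]] := listing_cover L (z := z) xi.
  - by move=> f /(xg _ _ yk); rewrite evalq_real_complex => ->.
  - by apply: contraNneq nk => /complexI gk; rewrite -(hg _ _ yk) gk hx.
  - by exists j.
  - case: (listing_nonreal L (j := j) (c := evalq g (tnth cr' k))); rewrite je.
    by case: e {je}; rewrite /conj_if ?conjc_real.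
have cplx k : exists je : 'I_s * bool,
    tnth cc je.1 = conj_if je.2 (evalq g (tnth cc' k)).
  have [yk nk] := listing_complex L' k.
  have [| |[j e]|[j [e je]]] := listing_cover L (z := evalq g (tnth cc' k)) xi.
  - exact: xg.
  - by apply: contraNneq nk => gk; rewrite -(hg _ _ yk) gk evalq_real_complex hx.
  (* If g sent a non-real conjugate to a real number, [h] would send it back to a real number. *)
  - case: (listing_nonreal L' (j := k) (c := evalq h (tnth cr j))).
    by rewrite -evalq_real_complex -e hg.
  - by exists (j, e).
have [sg sgE] := choice real; have [te teE] := choice cplx.
exists g, sg, (fst \o te), (snd \o te); split=> //.
- move=> i j e; apply: (listing_real_inj L').
  have [[yi _] [yj _]] := (listing_real L' i, listing_real L' j).
  by rewrite -(hg _ _ yi) -(hg _ _ yj) -!sgE e.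
(* Applying [h] to equal images shows that the entries at [i] and [j] agree up to conjugation, which
   the listing allows only for [i = j]. *)
- move=> i j /= e.
  have [[yi _] [yj _]] := (listing_complex L' i, listing_complex L' j).
  have := teE i; rewrite e teE => /(congr1 (conj_if (te j).2)).
  rewrite conj_ifK -!evalq_conj_if.
  move=> gij; have : tnth cc' j = conj_if (te j).2 (conj_if (te i).2 (tnth cc' i)).
    rewrite -(hg _ _ yj) gij !evalq_conj_if hg //.
  rewrite -[X in _ = X](_ : conj_if ((te i).2 (+) (te j).2) (tnth cc' i) = _).
    by move=> /esym /(listing_complex_inj L') [].
  by case: (te i).2; case: (te j).2 => //=; rewrite conjcK.
Qed.

End ConjugateListings.

(** * Real-linear coordinate changes between the two spaces *)

Section CoordinateChange.
Variables (R : realType) (r s r' s' : nat).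
Variables (sg : 'I_r' -> 'I_r) (tau : 'I_s' -> 'I_s) (e : 'I_s' -> bool).
Variable u : Kspace R r' s'.

Definition coord_change (x : Kspace R r s) : Kspace R r' s' :=
  Kmul u (\row_k x.1 0 (sg k), \row_k (conj_if (e k) (x.2 0 (tau k)) : R[i]^o)).

Lemma conj_ifD b : {morph @conj_if R b : x y / x + y >-> x + y}.
Proof. by case: b => x y //=; rewrite rmorphD. Qed.

Lemma conj_ifM b : {morph @conj_if R b : x y / x * y >-> x * y}.
Proof. by case: b => x y //=; rewrite rmorphM. Qed.

(** Complex conjugation commutes with real scalars, and the spaces are taken over [R]. *)
Lemma coord_change_linear : linear coord_change.
Proof.
move=> a x y; apply: Kspace_eq => k; rewrite !mxE; first by ring.
rewrite conj_ifD conj_ifM.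
have -> : conj_if (e k) a%:C%C = a%:C%C by case: (e k); rewrite /conj_if ?conjc_real.
by ring.
Qed.

HB.instance Definition _ :=
  GRing.isLinear.Build R (Kspace R r s) (Kspace R r' s') *:%R coord_change
    coord_change_linear.

(** The injections [sg] and [tau] already give r' <= r and s' <= s; with the opposite inequalities
    they are bijections. *)
Lemma coord_change_bij : injective sg -> injective tau ->
  (r <= r')%N -> (s <= s')%N ->
  (forall k, u.1 0 k != 0) -> (forall k, u.2 0 k != 0) -> bijective coord_change.
Proof.
move=> sgi taui rr ss u1 u2.
have [sg' sgK sgK'] : bijective sg by apply: inj_card_bij; rewrite ?card_ord.
have [tau' tauK tauK'] : bijective tau by apply: inj_card_bij; rewrite ?card_ord.
exists (fun y : Kspace R r' s' => (\row_k (y.1 0 (sg' k) / u.1 0 (sg' k)),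
  \row_k (conj_if (e (tau' k)) (y.2 0 (tau' k) / u.2 0 (tau' k)) : R[i]^o))
  : Kspace R r s) => x; apply: Kspace_eq => k; rewrite !mxE.
- by rewrite sgK' mulrC mulKf.
- rewrite [_ / _]mulrC mulKf // tauK'; exact: conj_ifK.
- by rewrite sgK mulrC mulfVK.
- rewrite tauK conj_ifK mulrC; exact: mulfVK.
Qed.

Lemma conj_if_continuous b : continuous (conj_if b : R[i]^o -> R[i]^o).
Proof.
case: b => z A; last by [].
move=> /nbhs_ballP [d d0 zA]; apply/nbhs_ballP; exists d => // w zw; apply: zA.
by move: zw; rewrite /ball /= -rmorphB normcJ.
Qed.

Lemma Kspace_continuous (f : Kspace R r s -> Kspace R r' s') :
  (forall k, continuous (fun x => (f x).1 0 k)) ->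
  (forall k, continuous (fun x => (f x).2 0 k : R[i]^o)) -> continuous f.
Proof. by move=> f1 f2 x; apply: Kspace_cvg => k; [apply: f1|apply: f2]. Qed.

Lemma coord_change_continuous : continuous coord_change.
Proof.
apply: Kspace_continuous => k.
  have -> : (fun x => (coord_change x).1 0 k) =
      fun x : Kspace R r s => u.1 0 k * x.1 0 (sg k).
    by apply/funext => y; rewrite !mxE.
  by move=> x; apply: cvgM; [apply: cvg_cst | apply: coord1_continuous].
have -> : (fun x => (coord_change x).2 0 k) =
    fun x : Kspace R r s => u.2 0 k * conj_if (e k) (x.2 0 (tau k)).
  by apply/funext => y; rewrite !mxE.
move=> x; apply: (@cvgM R[i]); first exact: cvg_cst.
apply: (@continuous_comp _ _ _ (fun x : Kspace R r s => x.2 0 (tau k) : R[i]^o)).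
  exact: coord2_continuous.
exact: conj_if_continuous.
Qed.

End CoordinateChange.

Lemma Kaffine_continuous (R : realType) r s (c u : Kspace R r s) :
  continuous (fun x => c + Kmul u x).
Proof.
apply: Kspace_continuous => k.
  have -> : (fun x => (c + Kmul u x).1 0 k) =
      fun x : Kspace R r s => c.1 0 k + u.1 0 k * x.1 0 k.
    by apply/funext => y; rewrite !mxE.
  move=> x; apply: cvgD; first exact: cvg_cst.
  by apply: cvgM; [apply: cvg_cst | apply: coord1_continuous].
have -> : (fun x => (c + Kmul u x).2 0 k) =
    fun x : Kspace R r s => c.2 0 k + u.2 0 k * x.2 0 k.
  by apply/funext => y; rewrite !mxE.
move=> x; apply: (@cvgD R[i] R[i]^o); first exact: cvg_cst.
by apply: (@cvgM R[i]); [apply: cvg_cst | apply: coord2_continuous].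
Qed.

(** * Identification of the Rauzy subtiles with the tiles X_k *)

Section RauzyTiles.
Variables (R : realType) (alpha beta : R) (p : nat).
Hypotheses (hp : (p == 3) || (~~ odd p) && (4 <= p)%N).
Hypotheses (ai : algebraic_integer alpha) (bpisot : pisot_number beta).
Hypotheses (a1 : 1 < alpha) (bE : beta = alpha / (alpha - 1)).
Hypotheses (abD : alpha * beta = alpha + beta) (ab : alpha ^+ 2 = beta ^+ p).

Let lam := if odd p then beta else beta ^+ 2.

Variables (r s : nat) (cr : r.-tuple R) (cc : s.-tuple R[i]).
Hypothesis L : conjugate_listing alpha cr cc.
Variables (r' s' : nat) (cr' : r'.-tuple R) (cc' : s'.-tuple R[i]).
Hypothesis L' : conjugate_listing lam cr' cc'.
Variable nu : 'rV[R]_(top_letter p).+1.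
Hypothesis hnu : left_eigenvector (@zeta' p) lam nu.
Variable F : set (Kspace R r s).
Hypothesis hF : is_tent_tile alpha cr cc F.
Variable T : 'I_(top_letter p).+1 -> set (Kspace R r' s').
Hypothesis hT : is_rauzy lam cr' cc' nu (@zeta' p) T.

Lemma rauzy_tiles : exists Phi : {linear Kspace R r s -> Kspace R r' s'},
  bijective Phi /\
  forall k : 'I_(top_letter p).+1,
    T k = [set Phi x | x in Xtile alpha beta cr cc F p k].
Proof.
have p3 : (3 <= p)%N by case/orP: hp => [/eqP->|/andP [_ /ltnW]].
have b1 : 1 < beta by case: bpisot.
have b0 : beta != 0 by rewrite gt_eqF // (lt_trans _ b1).
have a0 : alpha != 0 by rewrite gt_eqF // (lt_trans _ a1).
have bp1 := beta_expp1 p3 a1 b1 abD ab.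
have fb := in_field_alpha_beta a1 abD ai.
have fl := in_field_alpha_lam p a1 abD ai.
have li := lam_algebraic_integer p bpisot.
have lf := in_field_lam_alpha p3 a1 b1 abD ab bpisot.
have lpisot := pisot_lam p3 a1 b1 abD ab bpisot.
have fw k : in_field alpha (letter_weight alpha beta p k).
  by rewrite /letter_weight; case: ifP => _; [apply: in_field_id | apply: in_fieldX].
have [g [sg [tau [e [gE sgi taui sgE tauE]]]]] := listing_transport L L' ai lf fl.
(* The reverse transport serves to compare the numbers of conjugates. *)
have [_ [sg' [tau' [_ [_ sgi' taui' _ _]]]]] := listing_transport L' L li fl lf.
have rr : (r <= r')%N by have := leq_card sg' sgi'; rewrite !card_ord.
have ss : (s <= s')%N by have := leq_card tau' taui'; rewrite !card_ord.
have sr k : specializes alpha (tnth cr k) by case: (listing_real L k).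
have sc k : specializes alpha (tnth cc k) by case: (listing_complex L k).
have sr' k : specializes lam (tnth cr' k) by case: (listing_real L' k).
have sc' k : specializes lam (tnth cc' k) by case: (listing_complex L' k).
have [nuE nuF] := hnu.
(* As alpha is the weight of letter 0, [c0] is the ratio of [nu] to the opposite weights; it is
   negative. *)
pose c0 := - (nu 0 0 / alpha).
have c0F : in_field lam c0.
  by apply: in_fieldN; apply: in_fieldM; [case: (nuF 0)|apply: in_fieldV].
have c00 : c0 != 0 by rewrite oppr_eq0 mulf_neq0 ?invr_neq0 // gt_eqF //; case: (nuF 0).
have nuw i : nu 0 i = c0 * - letter_weight alpha beta p i.
  have := @eigenvector_unique _ (@zeta' p) R lam
    (fun k => letter_weight alpha beta p k) _ _ _ _ (fun k => nu 0 k) _ i 0.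
  rewrite letter_weight0 /c0 mulrNN mulrAC => eq0; apply: (mulIf a0).
  rewrite mulfVK // eq0 //.
  - exact: zeta'_primitive.
  - by case: lpisot => _ /(lt_trans ltr01).
  - by move=> j; apply: letter_weight_gt0.
  - by move=> j; rewrite sum_zeta' // sum_letter_weight // leq_ord.
  - by apply/mul_incidence_eq.
pose u := psi lam cr' cc' c0.
pose Phi : {linear Kspace R r s -> Kspace R r' s'} := coord_change sg tau e u.
have u1 k : u.1 0 k != 0 by rewrite mxE field_image_neq0.
have u2 k : u.2 0 k != 0 by rewrite mxE field_image_neq0.
have e1 z k : in_field alpha z ->
    field_image alpha (tnth cr (sg k)) z = field_image lam (tnth cr' k) z.
  by move=> fz; rewrite sgE; apply: (field_image_trans gE).
have e2 z k : in_field alpha z ->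
    conj_if (e k) (field_image alpha (tnth cc (tau k)) z) =
    field_image lam (tnth cc' k) z.
  move=> fz; rewrite -(field_image_trans gE (sc' k) fz).
  move: fz => [f <-]; rewrite -/(evalq f alpha) !field_image_evalq //.
    by rewrite tauE evalq_conj_if conj_ifK.
  by rewrite gE; apply: specializes_evalq.
(* [Phi] sends the embedding of z to that of c0 z and, by [PhiB], intertwines multiplication by
   elements of Q(alpha). It therefore carries the affine maps of the tile system to those of the
   Rauzy system. *)
have PhiA z : in_field alpha z -> Phi (psi alpha cr cc z) = psi lam cr' cc' (c0 * z).
  move=> fz; rewrite (psiM sr' sc') //; last exact: in_field_trans lf fz.
  by apply: Kspace_eq => k; rewrite !mxE ?e1 ?e2.
have PhiB z x : in_field alpha z ->
    Phi (Kmul (psi alpha cr cc z) x) = Kmul (psi lam cr' cc' z) (Phi x).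
  move=> fz; apply: Kspace_eq => k; rewrite !mxE ?e1 //; first exact: mulrCA.
  by rewrite conj_ifM e2 // mulrCA.
exists Phi; split; first exact: coord_change_bij.
pose Y k := [set Phi x | x in Xtile alpha beta cr cc F p k].
pose v : Kspace R r' s' := (\row_k tnth cr' k, \row_k (tnth cc' k : R[i]^o)).
have vE : psi lam cr' cc' lam = v.
  by apply: Kspace_eq => k; rewrite !mxE field_image_id.
pose E (a b : 'I_(top_letter p).+1) (c : Kspace R r' s') := exists U V,
  zeta' b = U ++ a :: V /\ c = psi lam cr' cc' ((nu *m map_mx intr (ell U)) 0 0).
have fcoef k := in_field_tile_coef fb p k.
have offF U : in_field alpha (- \sum_(x <- U) letter_weight alpha beta p x).
  apply: in_fieldN; elim: U => [|x U IH]; first by rewrite big_nil; apply: in_field0.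
  by rewrite big_cons; apply: in_fieldD.
(* One edge seen through [Phi]: by [nuU], c0 times the opposite weight of a prefix is its
   [nu]-weight, as in [gmap]. *)
have step U b x : (exists2 y, edge_piece alpha cr cc F beta p b U y & Phi y = x) <->
    exists2 y, (Phi @` piece alpha cr cc F (tile_coef alpha beta p b).1
      (tile_coef alpha beta p b).2) y &
      x = psi lam cr' cc' (c0 * - \sum_(x <- U) letter_weight alpha beta p x) + Kmul v y.
  have [fc fd] := fcoef b.
  split=> [[y /(piece_affine sr sc F _ (offF U) fl fc fd) [z zp ->] <-]|[_ [z zp <-] ->]].
    exists (Phi z); first by exists z.
    by rewrite linearD /= PhiA // PhiB // vE.
  exists (psi alpha cr cc (- \sum_(x <- U) letter_weight alpha beta p x) +
          Kmul (psi alpha cr cc lam) z).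
    by apply/(piece_affine sr sc F _ (offF U) fl fc fd); exists z.
  by rewrite linearD /= PhiA // PhiB // vE.
have nuU (U : seq 'I_(top_letter p).+1) : (nu *m map_mx intr (ell U)) 0 0 =
    c0 * - \sum_(x <- map val U) letter_weight alpha beta p x.
  by rewrite mul_ell big_map -sumrN mulr_sumr; apply: eq_bigr => i _; apply: nuw.
have TE : graph_ifs v E T.
  move=> a; have [_ _ ->] := hT a; apply/seteqP; split=> x.
    move=> [b [U [V [zb [y Ty <-]]]]].
    by exists b; eexists; exists y; split; [exists U, V|..].
  move=> [b [_ [y [[U [V [zb ->]]] Ty ->]]]].
  by exists b, U, V; split=> //; exists y.
have YE : graph_ifs v E Y.
  move=> a; have aT := leq_ord a; rewrite /Y (Xtile_piece sr sc F fb) //.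
  have sys w := tile_system sr sc hF bE fb hp b0 abD ab bp1 w aT.
  apply/seteqP; split=> x.
    move=> [w /sys [b [U [V [bT zb wp]]]] wx].
    have [y Yy ->] := (step U b x).1 (ex_intro2 _ _ w wp wx).
    have zb' : zeta' (inord b : 'I_(top_letter p).+1) = map inord U ++ a :: map inord V.
      by rewrite /zeta' inordK ?ltnS // zb map_cat /= inord_val.
    exists (inord b), (psi lam cr' cc' ((nu *m map_mx intr (ell (map inord U))) 0 0)), y.
    split.
    - by exists (map inord U), (map inord V).
    - by rewrite (Xtile_piece sr sc F fb) // inordK.
    - rewrite nuU; suff -> : map val (map (@inord (top_letter p)) U) = U by [].
      rewrite -map_comp -[RHS]map_id; apply/eq_in_map => j jU /=.
      by rewrite inordK // ltnS (zeta_word_top p3 bT) // zb mem_cat jU.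
  move=> [b [_ [y [[U [V [zb ->]]] Yy ->]]]].
  move: Yy; rewrite (Xtile_piece sr sc F fb) ?leq_ord // => Yy.
  rewrite nuU; have [w wp wx] := (step (map val U) b _).2 (ex_intro2 _ _ y Yy erefl).
  exists w => //; apply/sys; exists b, (map val U), (map val V); split=> //.
    exact: leq_ord.
  by rewrite -val_zeta' // zb map_cat.
apply: (@graph_ifs_unique _ _ _ _ v E) => //.
(* The coordinates of [v] are conjugates of the Pisot number [lam] other than itself, so the system
   contracts. *)
- move=> k; rewrite mxE; have [_ _ small] := lpisot; have [sk nk] := listing_real L' k.
  rewrite -ltcR -cabs_real cabsE; apply: small; last by rewrite (inj_eq (@complexI R)).
  apply: specializes_galois_conjugate => // f /sk.
  by rewrite evalq_real_complex => ->.
- move=> k; rewrite mxE; have [_ _ small] := lpisot; have [sk nk] := listing_complex L' k.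
  by rewrite -ltcR cabsE; apply: small => //; apply: specializes_galois_conjugate.
- by move=> a; have [] := hT a.
- move=> a; rewrite /Y (Xtile_piece sr sc F fb) ?leq_ord //.
  have [F0 Fc _] := hF; split; first by do 2!apply: image_nonempty.
  apply: continuous_compact.
    by apply: continuous_subspaceT; apply: coord_change_continuous.
  apply: continuous_compact => //.
  by apply: continuous_subspaceT; apply: Kaffine_continuous.
Qed.

End RauzyTiles.

Theorem theorem4p8 (R : realType) (alpha beta : R) (p : nat)
    (halpha : special_pisot_unit alpha)
    (hbeta : beta = alpha / (alpha - 1))
    (hp : (3 <= p)%N)
    (hab : alpha ^+ 2 = beta ^+ p) :
  let lam := if odd p then beta else beta ^+ 2 in
  [/\ nonerasing (@zeta' p), primitive_subst (@zeta' p),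
      unimodular (@zeta' p), pisot_subst R (@zeta' p)
    & dominant_root (@zeta' p) lam] /\
  forall (r s : nat) (cr : r.-tuple R) (cc : s.-tuple R[i]),
    conjugate_listing alpha cr cc ->
  forall (r' s' : nat) (cr' : r'.-tuple R) (cc' : s'.-tuple R[i]),
    conjugate_listing lam cr' cc' ->
  forall nu : 'rV[R]_(top_letter p).+1,
    left_eigenvector (@zeta' p) lam nu ->
  forall F : set (Kspace R r s), is_tent_tile alpha cr cc F ->
  forall T : 'I_(top_letter p).+1 -> set (Kspace R r' s'),
    is_rauzy lam cr' cc' nu (@zeta' p) T ->
  p \in [:: 3; 4; 6; 8; 10]%N ->
  exists Phi : {linear Kspace R r s -> Kspace R r' s'},
    bijective Phi /\
    forall k : 'I_(top_letter p).+1,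
      T k = [set Phi x | x in Xtile alpha beta cr cc F p k].
Proof.
move=> lam; have [[ai a1 _] _ bpisot] := halpha; rewrite -hbeta in bpisot.
have b1 : 1 < beta by case: bpisot.
have abD : alpha * beta = alpha + beta.
  have e : beta * (alpha - 1) = alpha by rewrite hbeta mulfVK // subr_eq0 gt_eqF.
  by rewrite -{2}e; ring.
have dom := dominant_root_zeta' hp a1 b1 abD hab.
split.
  split=> //.
  - exact: zeta'_nonerasing.
  - exact: zeta'_primitive.
  - exact: zeta'_unimodular.
  - by exists lam => //; apply: (pisot_lam hp a1 b1 abD hab bpisot).
move=> r s cr cc L r' s' cr' cc' L' nu hnu F hF T hT p10.
have hp' : (p == 3) || (~~ odd p) && (4 <= p)%N by move: p10; rewrite !inE; lia.
exact: (rauzy_tiles hp' ai bpisot a1 hbeta abD hab L L' hnu hF hT).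
Qed.
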